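(* Let $M$ be a 4-dimensional LP-Sasakian manifold which is conformally flat, quasi conformally flat or conformally symmetric, and let $\gamma:I\to M$ be a spacelike curve parametrized by arclength. Suppose that $\{T,N,B_1,B_2\}$ is an orthonormal Frenet frame field tangent to $M$ along $\gamma$ such that $g(T,T)=g(B_1,B_1)=g(B_2,B_2)=1$ and $g(N,N)=-1$. Then $\gamma$ is a biharmonic curve if and only if it is a geodesic of $M$.
   Context: LP-Sasakian manifold: an $n$-dimensional smooth manifold $M$ with a $(1,1)$-tensor field $\phi$, a vector field $\xi$, a 1-form $\eta$ and a Lorentzian metric $g$ of signature $(-,+,\dots,+)$ such that $\eta(\xi)=-1$, $\phi^2=I+\eta\otimes\xi$, $g(\phi X,\phi Y)=g(X,Y)+\eta(X)\eta(Y)$ (so that $g(X,\xi)=\eta(X)$), and $(\nabla_X\phi)Y=g(\phi X,\phi Y)\xi+\eta(Y)\phi^2X$ for all vector fields $X,Y$, where $\nabla$ is the Levi-Civita connection of $g$. Curvature: $R(X,Y)=[\nabla_X,\nabla_Y]-\nabla_{[X,Y]}$; $S$ is the Ricci tensor, $Q$ is given by $S(X,Y)=g(QX,Y)$, and $r$ is the scalar curvature. The conformal curvature tensor is $C(X,Y)Z=R(X,Y)Z-\frac{1}{n-2}\{g(Y,Z)QX-g(X,Z)QY+S(Y,Z)X-S(X,Z)Y\}+\frac{r}{(n-1)(n-2)}\{g(Y,Z)X-g(X,Z)Y\}$. The quasi-conformal curvature tensor is $\widetilde C(X,Y)Z=aR(X,Y)Z+b\{S(Y,Z)X-S(X,Z)Y+g(Y,Z)QX-g(X,Z)QY\}-\frac{r}{n}\left(\frac{a}{n-1}+2b\right)\{g(Y,Z)X-g(X,Z)Y\}$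 with constants $a,b$, $ab\neq0$. $M$ is conformally flat if $C=0$, quasi conformally flat if $\widetilde C=0$ (for such constants), conformally symmetric if $\nabla C=0$. Here $n=4$. Curves: $I\subset\mathbb R$ is an interval, $T=\gamma'$, and $\gamma$ is spacelike parametrized by arclength if $g(T,T)=1$. $\gamma$ is biharmonic if $\nabla_T^3T-R(T,\nabla_TT)T=0$, and a geodesic if $\nabla_TT=0$. Frenet frame in this case: $T,N,B_1,B_2$ are mutually orthogonal and $\nabla_TT=k_1N$, $\nabla_TN=k_1T+k_2B_1$, $\nabla_TB_1=k_2N+k_3B_2$, $\nabla_TB_2=-k_3B_1$, where the curvatures $k_1,k_2,k_3$ are smooth functions. *)

(* Defs.v *)
From HB Require Import structures.
From mathcomp Require Import all_boot all_order all_algebra.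
From mathcomp Require Import all_classical all_reals all_analysis.

Set Implicit Arguments.
Unset Strict Implicit.
Unset Printing Implicit Defensive.

Import Order.TTheory GRing.Theory Num.Theory.
Import numFieldNormedType.Exports.

Local Open Scope classical_set_scope.
Local Open Scope ring_scope.

(** * Smooth maps between (open subsets of) normed spaces

    Only meant for an open set [U]: differentiability at a point of [U] is then
    insensitive to the junk values of [f] outside [U]. *)

Section Smooth.
Variables (R : realType) (V W : normedModType R).

Fixpoint Ck (k : nat) (U : set V) (f : V -> W) : Prop :=
  if k is k'.+1 then
    (forall x, U x -> differentiable f x) /\
    (forall v, Ck k' U (fun x => 'D_v f x))
  else forall x, U x -> {for x, continuous f}.

Definition smooth_on (U : set V) (f : V -> W) := forall k, Ck k U f.

Definition smooth_at (x : V) (f : V -> W) :=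
  exists2 U, open_nbhs x U & smooth_on U f.

End Smooth.

(** * Tensor calculus on an open subset of R^n

    Tangent vectors are row vectors. A vector field is a map ['rV_n -> 'rV_n];
    a (1,1)-tensor [A] acts by [v |-> v *m A], a bilinear form with Gram matrix
    [G] by [(u, v) |-> u *m G *m v^T], a 1-form is a column vector. *)

Section ChartCalculus.
Variables (R : realType) (n : nat).

Definition field := 'rV[R]_n -> 'rV[R]_n.

Definition ebase (k : 'I_n) : 'rV[R]_n := delta_mx 0 k.

Definition bilin (G : 'M[R]_n) (u v : 'rV[R]_n) : R := (u *m G *m v^T) 0 0.

Definition form1 (h : 'cV[R]_n) (u : 'rV[R]_n) : R := (u *m h) 0 0.

(* [Gam k l] is the vector nabla_{e_k} e_l. *)
Definition christoffel (Gam : 'I_n -> 'I_n -> 'rV[R]_n) (u v : 'rV[R]_n)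
    : 'rV[R]_n :=
  \sum_k \sum_l (u 0 k * v 0 l) *: Gam k l.

Definition lie_bracket (X Y : field) : field :=
  fun x => 'D_(X x) Y x - 'D_(Y x) X x.

Variable Gam : 'rV[R]_n -> 'I_n -> 'I_n -> 'rV[R]_n.

Definition nabla (X Y : field) : field :=
  fun x => 'D_(X x) Y x + christoffel (Gam x) (X x) (Y x).

Definition curvature (X Y Z : field) : field :=
  fun x => nabla X (nabla Y Z) x - nabla Y (nabla X Z) x
           - nabla (lie_bracket X Y) Z x.

(* R(u,v)w for tangent vectors at [x]; by tensoriality any extension of the
   vectors to fields may be used, here the constant one. *)
Definition curvature_at (x u v w : 'rV[R]_n) : 'rV[R]_n :=
  curvature (fun=> u) (fun=> v) (fun=> w) x.

(* S(Y,Z) is the trace of X |-> R(X,Y)Z. *)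
Definition ricci_mx (x : 'rV[R]_n) : 'M[R]_n :=
  \matrix_(p, q) \sum_k curvature_at x (ebase k) (ebase p) (ebase q) 0 k.

Definition ricci (x u v : 'rV[R]_n) : R := bilin (ricci_mx x) u v.

Variable g : 'rV[R]_n -> 'M[R]_n.

(* For nondegenerate [g] this is the only matrix with S(u,v) = g(Qu,v). *)
Definition ricci_op (x : 'rV[R]_n) : 'M[R]_n := ricci_mx x *m invmx (g x).

Definition scalar_curv (x : 'rV[R]_n) : R := \tr (ricci_op x).

Definition conformal_curv (X Y Z : field) : field := fun x =>
  let gx := bilin (g x) in
  curvature X Y Z x
  - (n%:R - 2)^-1 *:
      (gx (Y x) (Z x) *: (X x *m ricci_op x)
       - gx (X x) (Z x) *: (Y x *m ricci_op x)
       + ricci x (Y x) (Z x) *: X x - ricci x (X x) (Z x) *: Y x)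
  + (scalar_curv x / ((n%:R - 1) * (n%:R - 2))) *:
      (gx (Y x) (Z x) *: X x - gx (X x) (Z x) *: Y x).

Definition quasi_conformal_curv (a b : R) (X Y Z : field) : field := fun x =>
  let gx := bilin (g x) in
  a *: curvature X Y Z x
  + b *: (ricci x (Y x) (Z x) *: X x - ricci x (X x) (Z x) *: Y x
          + gx (Y x) (Z x) *: (X x *m ricci_op x)
          - gx (X x) (Z x) *: (Y x *m ricci_op x))
  - (scalar_curv x / n%:R * (a / (n%:R - 1) + 2 * b)) *:
      (gx (Y x) (Z x) *: X x - gx (X x) (Z x) *: Y x).

(* (nabla_W A)Y for a (1,1)-tensor field A *)
Definition nabla_endo (A : 'rV[R]_n -> 'M[R]_n) (W Y : field) : field :=
  fun x => nabla W (fun z => Y z *m A z) x - nabla W Y x *m A x.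

(* (nabla_W C)(X,Y)Z for a (1,3)-tensor field C *)
Definition nabla_curvlike (C : field -> field -> field -> field)
    (W X Y Z : field) : field :=
  fun x => nabla W (C X Y Z) x - C (nabla W X) Y Z x
           - C X (nabla W Y) Z x - C X Y (nabla W Z) x.

End ChartCalculus.

(** * Smooth manifolds and tensor fields

    A manifold of dimension [n] is a Hausdorff second countable space with a
    smooth atlas. [chart_inv i] is an inverse of [chart i] between
    [chart_dom i] and its image; both are total, with irrelevant values
    elsewhere. *)

Record manifold (R : realType) (n : nat) := Manifold {
  carrier :> topologicalType ;
  carrier_hausdorff : hausdorff_space carrier ;
  carrier_second_countable : @second_countable carrier ;
  chart_ix : Type ;
  chart_dom : chart_ix -> set carrier ;
  chart : chart_ix -> carrier -> 'rV[R]_n ;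
  chart_inv : chart_ix -> 'rV[R]_n -> carrier ;
  chart_dom_open : forall i, open (chart_dom i) ;
  chart_cover : forall p, exists i, chart_dom i p ;
  chart_image_open : forall i, open (chart i @` chart_dom i) ;
  chartK : forall i p, chart_dom i p -> chart_inv i (chart i p) = p ;
  chart_continuous : forall i p, chart_dom i p -> {for p, continuous (chart i)} ;
  chart_inv_continuous : forall i x, (chart i @` chart_dom i) x ->
    {for x, continuous (chart_inv i)} ;
  chart_smooth : forall i j,
    smooth_on (chart i @` (chart_dom i `&` chart_dom j))
              (chart j \o chart_inv i)
}.

Section TensorFields.
Variables (R : realType) (n : nat) (M : manifold R n).
Implicit Types i j : chart_ix M.

Definition chart_img i : set 'rV[R]_n := chart i @` chart_dom i.

Definition overlap i j : set 'rV[R]_n :=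
  chart i @` (chart_dom i `&` chart_dom j).

Definition transition i j : 'rV[R]_n -> 'rV[R]_n := chart j \o chart_inv i.

(* [v *m trans_jac i j x] is the differential of the change of charts at [x]
   applied to [v]. *)
Definition trans_jac i j (x : 'rV[R]_n) : 'M[R]_n := jacobian (transition i j) x.

(* Tensor fields are given by their components in every chart, smooth and
   subject to the transformation law of their type under change of charts. *)

Record vector_field := VectorField {
  vf_comp :> chart_ix M -> 'rV[R]_n -> 'rV[R]_n ;
  vf_smooth : forall i, smooth_on (chart_img i) (vf_comp i) ;
  vf_trans : forall i j x, overlap i j x ->
    vf_comp j (transition i j x) = vf_comp i x *m trans_jac i j x
}.

Record one_form := OneForm {
  of_comp :> chart_ix M -> 'rV[R]_n -> 'cV[R]_n ;
  of_smooth : forall i, smooth_on (chart_img i) (of_comp i) ;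
  of_trans : forall i j x, overlap i j x ->
    of_comp i x = trans_jac i j x *m of_comp j (transition i j x)
}.

Record endo_field := EndoField {
  ef_comp :> chart_ix M -> 'rV[R]_n -> 'M[R]_n ;
  ef_smooth : forall i, smooth_on (chart_img i) (ef_comp i) ;
  ef_trans : forall i j x, overlap i j x ->
    ef_comp i x *m trans_jac i j x =
    trans_jac i j x *m ef_comp j (transition i j x)
}.

(* Gram matrix of the signature (-,+,...,+) in an orthonormal basis *)
Definition minkowski_mx : 'M[R]_n :=
  diag_mx (\row_(j < n) if j == 0%N :> nat then - 1 else 1).

(* The rows of [P] in [lm_signature] form an orthonormal basis of the tangent
   space. *)
Record lorentz_metric := LorentzMetric {
  lm_comp :> chart_ix M -> 'rV[R]_n -> 'M[R]_n ;
  lm_smooth : forall i, smooth_on (chart_img i) (lm_comp i) ;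
  lm_trans : forall i j x, overlap i j x ->
    lm_comp i x =
    trans_jac i j x *m lm_comp j (transition i j x) *m (trans_jac i j x)^T ;
  lm_sym : forall i x, chart_img i x -> (lm_comp i x)^T = lm_comp i x ;
  lm_signature : forall i x, chart_img i x ->
    exists2 P : 'M[R]_n, P \in unitmx & P *m lm_comp i x *m P^T = minkowski_mx
}.

(* An affine connection, given by nabla_{e_k} e_l in every chart; the law of
   transformation is the classical inhomogeneous one. *)
Record connection := Connection {
  cn_comp :> chart_ix M -> 'rV[R]_n -> 'I_n -> 'I_n -> 'rV[R]_n ;
  cn_smooth : forall i k l, smooth_on (chart_img i) (fun x => cn_comp i x k l) ;
  cn_trans : forall i j x k l, overlap i j x ->
    cn_comp i x k l *m trans_jac i j x =
    'D_(ebase R k) (fun z => 'D_(ebase R l) (transition i j) z) x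
    + christoffel (cn_comp j (transition i j x))
        (ebase R k *m trans_jac i j x) (ebase R l *m trans_jac i j x)
}.

Variables (g : lorentz_metric) (D : connection).

(* Here and below, identities between tensors are tested on the smooth vector
   fields defined on chart domains. *)
Definition is_levi_civita : Prop :=
  forall i (X Y : field R n),
    smooth_on (chart_img i) X -> smooth_on (chart_img i) Y ->
  (forall x, chart_img i x ->
     nabla (D i) X Y x - nabla (D i) Y X x = lie_bracket X Y x) /\
  (forall (Z : field R n) x, smooth_on (chart_img i) Z -> chart_img i x ->
     'D_(Z x) (fun z => bilin (g i z) (X z) (Y z) : R^o) x =
     bilin (g i x) (nabla (D i) Z X x) (Y x)
     + bilin (g i x) (X x) (nabla (D i) Z Y x)).

Record is_LP_sasakian (phi : endo_field) (xi : vector_field) (eta : one_form)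
    : Prop := {
  lp_levi_civita : is_levi_civita ;
  lp_eta_xi : forall i x, chart_img i x -> form1 (eta i x) (xi i x) = - 1 ;
  lp_phi2 : forall i x (u : 'rV[R]_n), chart_img i x ->
    u *m phi i x *m phi i x = u + form1 (eta i x) u *: xi i x ;
  lp_compat : forall i x (u v : 'rV[R]_n), chart_img i x ->
    bilin (g i x) (u *m phi i x) (v *m phi i x) =
    bilin (g i x) u v + form1 (eta i x) u * form1 (eta i x) v ;
  lp_nabla_phi : forall i (X Y : field R n) x,
    smooth_on (chart_img i) X -> smooth_on (chart_img i) Y -> chart_img i x ->
    nabla_endo (D i) (phi i) X Y x =
    bilin (g i x) (X x *m phi i x) (Y x *m phi i x) *: xi i x
    + form1 (eta i x) (Y x) *: (X x *m phi i x *m phi i x)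
}.

Definition conformally_flat : Prop :=
  forall i (X Y Z : field R n) x,
    smooth_on (chart_img i) X -> smooth_on (chart_img i) Y ->
    smooth_on (chart_img i) Z -> chart_img i x ->
  conformal_curv (D i) (g i) X Y Z x = 0.

Definition quasi_conformally_flat : Prop :=
  exists a b : R, a * b != 0 /\
  forall i (X Y Z : field R n) x,
    smooth_on (chart_img i) X -> smooth_on (chart_img i) Y ->
    smooth_on (chart_img i) Z -> chart_img i x ->
  quasi_conformal_curv (D i) (g i) a b X Y Z x = 0.

Definition conformally_symmetric : Prop :=
  forall i (W X Y Z : field R n) x,
    smooth_on (chart_img i) W -> smooth_on (chart_img i) X ->
    smooth_on (chart_img i) Y -> smooth_on (chart_img i) Z -> chart_img i x ->
  nabla_curvlike (D i) (conformal_curv (D i) (g i)) W X Y Z x = 0.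

(** ** Curves

    The interval [I] need not be open. As usual, an object defined on [I] is
    smooth if it extends smoothly to a neighbourhood of each point of [I]; the
    total functions on [R] below provide the extension, and their values
    are constrained on [I] only. *)

Definition nondegenerate_interval (I : set R) : Prop :=
  is_interval I /\ exists a b, [/\ I a, I b & a < b].

Definition smooth_fun (I : set R) (f : R -> R) : Prop :=
  forall t, I t -> smooth_at (t : R^o) (f : R^o -> R^o).

Variables (I : set R) (gamma : R -> M).

Definition smooth_curve : Prop :=
  forall i t, I t -> chart_dom i (gamma t) ->
  exists U : set R^o, [/\ open_nbhs (t : R^o) U,
    forall s, U s -> chart_dom i (gamma s)
  & smooth_on U (chart i \o gamma : R^o -> 'rV[R]_n)].

(* components, in every chart, of a vector tangent to [M] at [gamma t] *)
Definition along := chart_ix M -> R -> 'rV[R]_n.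

(* [V i t] is meaningful only if [gamma t] is in the domain of chart [i]. *)
Record field_along := FieldAlong {
  fa_comp :> chart_ix M -> R -> 'rV[R]_n ;
  fa_smooth : forall i t, I t -> chart_dom i (gamma t) ->
    smooth_at (t : R^o) (fa_comp i : R^o -> 'rV[R]_n) ;
  fa_trans : forall i j t, I t ->
    chart_dom i (gamma t) -> chart_dom j (gamma t) ->
    fa_comp j t = fa_comp i t *m trans_jac i j (chart i (gamma t))
}.

Definition velocity : along :=
  fun i t => 'D_1 (chart i \o gamma : R^o -> 'rV[R]_n) t.

Definition nablaT (V : along) : along := fun i t =>
  'D_1 (V i : R^o -> 'rV[R]_n) t
  + christoffel (D i (chart i (gamma t))) (velocity i t) (V i t).

Definition eq_along (V W : along) : Prop :=
  forall i t, I t -> chart_dom i (gamma t) -> V i t = W i t.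

Definition inner_along (V W : along) (c : R) : Prop :=
  forall i t, I t -> chart_dom i (gamma t) ->
  bilin (g i (chart i (gamma t))) (V i t) (W i t) = c.

Definition is_geodesic : Prop := eq_along (nablaT velocity) (fun _ _ => 0).

Definition is_biharmonic : Prop :=
  eq_along
    (fun i t => nablaT (nablaT (nablaT velocity)) i t
       - curvature_at (D i) (chart i (gamma t))
           (velocity i t) (nablaT velocity i t) (velocity i t))
    (fun _ _ => 0).

Definition spacelike_arclength : Prop := inner_along velocity velocity 1.

Record orthonormal_frame (T N B1 B2 : along) : Prop := {
  of_TT : inner_along T T 1 ;
  of_NN : inner_along N N (- 1) ;
  of_B1B1 : inner_along B1 B1 1 ;
  of_B2B2 : inner_along B2 B2 1 ;
  of_TN : inner_along T N 0 ;
  of_TB1 : inner_along T B1 0 ;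
  of_TB2 : inner_along T B2 0 ;
  of_NB1 : inner_along N B1 0 ;
  of_NB2 : inner_along N B2 0 ;
  of_B1B2 : inner_along B1 B2 0
}.

Record frenet_equations (T N B1 B2 : along) (k1 k2 k3 : R -> R) : Prop := {
  fr_T : eq_along (nablaT T) (fun i t => k1 t *: N i t) ;
  fr_N : eq_along (nablaT N) (fun i t => k1 t *: T i t + k2 t *: B1 i t) ;
  fr_B1 : eq_along (nablaT B1) (fun i t => k2 t *: N i t + k3 t *: B2 i t) ;
  fr_B2 : eq_along (nablaT B2) (fun i t => - k3 t *: B1 i t)
}.

End TensorFields.

(* Main.v *)
(* On an LP-Sasakian manifold, nabla xi = phi and R(X,Y)xi = eta(Y)X - eta(X)Y.
   Each of the three hypotheses then gives, at every point,
     R(X,Y)Z = g(Y,Z)X - g(X,Z)Y + c (h(Y,Z)PX - h(X,Z)PY)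
   with h = g + eta (x) eta, P = I + eta (x) xi and a function c.  This c need
   not vanish: -dt^2 + e^(2t) g0 is LP-Sasakian with phi = P for every Riemannian
   metric g0, and it is conformally flat as soon as g0 has constant curvature.
   Where c <> 0, the second Bianchi identity gives phi = f P with f = 1 or -1,
   and dc = 2 f c eta.

   Suppose that k1 <> 0 somewhere on a biharmonic curve.  The T-component of the
   biharmonic equation shows that k1 is locally constant, and the N-component
   reads k1^2 + k2^2 + 1 = c (eta(B1)^2 + eta(B2)^2).  For c = 0 this is absurd.
   Otherwise the derivatives of this relation, together with the Frenet
   equations, show that w = eta(B1)^2 + eta(B2)^2 is constant and that eta(N)
   is a root of a polynomial with constant coefficients, so that eta(N) and
   eta(T) are constant; but the derivative of eta(T) does not vanish. *)
Require Import Defs.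
From HB Require Import structures.
From mathcomp Require Import all_boot all_order all_algebra.
From mathcomp Require Import all_classical all_reals all_analysis.
From mathcomp Require Import ring lra.

Set Implicit Arguments.
Unset Strict Implicit.
Unset Printing Implicit Defensive.

Import Order.TTheory GRing.Theory Num.Theory.
Import numFieldNormedType.Exports.

Local Open Scope classical_set_scope.
Local Open Scope ring_scope.

(** * Smooth maps *)

Section Near.
Variables (R : numFieldType) (V W : normedModType R).

(** Two obstacles shape the argument. The coefficient [c] is obtained point by point, by choice,
    whereas the rigidity step differentiates it. Its regularity is recovered from the Ricci tensor,
    which equals [3 g + 2 c h]: [c] is a quotient of smooth functions near any point where some
    vector [u] has [h(u, u) != 0]. On the curve [u = T] serves, since [h(T, T) = 1 + eta(T)^2]. The
    sign [f] is taken as one third of the trace of [phi], which is smooth on the whole chart, so no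
    sign has to be chosen continuously. Secondly, [I] may contain endpoints, and nothing is known
    about the extensions beyond them. The equations are therefore differentiated on an open [J]
    inside [I] and close to the given point; in the converse direction, a field vanishing on [I] has
    zero derivative even at an endpoint, because points of [I] alone determine a derivative that
    exists. The polynomial satisfied by eta(N) is handled by repeated differentiation instead of
    isolating roots, until only its leading coefficient, which is positive, is left. *)

Lemma near_eq_differentiable (f g : V -> W) (x : V) :
  (\near x, f x = g x) -> differentiable f x -> differentiable g x.
Proof.
move=> fg df.
have [cd /eqaddoP fE] := (diff_locallyP x f).1 df.
have fgx : f x = g x := nbhs_singleton fg.
have gE : g \o shift x = cst (g x) + 'd f x +o_ (0 : V) id.
  apply/eqaddoP => e e0; have := fE e e0.
  move: fg; rewrite (near_shift 0 x) subr0 => fg.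
  by apply: filterS2 fg => y /= fgy; rewrite -fgx !fctE /= fgy.
by apply/diff_locallyP; rewrite (diff_unique cd gE).
Qed.
End Near.

Section Ck.
Variables (R : realType) (V : normedModType R).
Implicit Types (k : nat) (U : set V).

Lemma eq_on_near (W : Type) U (f g : V -> W) x : open U ->
  (forall x, U x -> f x = g x) -> U x -> \near x, f x = g x.
Proof.
by move=> oU fg Ux; near=> y; apply/fg; near: y; exact: open_nbhs_nbhs.
Unshelve. all: by end_near. Qed.

(** As [U] is open, values outside it do not affect derivatives at its points; this allows a
    function to be replaced by a formula that holds on [U] only. *)
Lemma Ck_ext (W : normedModType R) k U (f g : V -> W) : open U ->
  (forall x, U x -> f x = g x) -> Ck k U f -> Ck k U g.
Proof.
move=> oU; elim: k f g => [|k IH] f g fg /=.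
  move=> cf x Ux; rewrite /prop_for /continuous_at -fg//.
  apply: cvg_trans (cf x Ux); apply: near_eq_cvg.
  exact: eq_on_near fg Ux.
move=> [df Df]; split=> [x Ux|v].
  exact: near_eq_differentiable (eq_on_near oU fg Ux) (df x Ux).
by apply: IH (Df v) => x Ux; apply: near_eq_derive; exact: eq_on_near fg Ux.
Qed.

Lemma CkW (W : normedModType R) k U (f : V -> W) : Ck k.+1 U f -> Ck k U f.
Proof.
elim: k f => [|k IH] f [df Df]; last by split=> // v; exact: IH.
by move=> x Ux; exact/differentiable_continuous/df.
Qed.

Lemma Ck_cst (W : normedModType R) k U (a : W) : Ck k U (fun=> a).
Proof.
elim: k a => [|k IH] a /=; first by move=> x _; exact: cvg_cst.
split=> [x _|v]; first exact: differentiable_cst.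
suff -> : 'D_v (fun=> a) = (fun=> 0) :> (V -> W) by [].
by apply/funext => x; rewrite derive_cst.
Qed.

Lemma CkD (W : normedModType R) k U (f g : V -> W) : open U ->
  Ck k U f -> Ck k U g -> Ck k U (fun x => f x + g x).
Proof.
move=> oU; elim: k f g => [|k IH] f g /=.
  by move=> cf cg x Ux; exact: cvgD (cf x Ux) (cg x Ux).
move=> [df Df] [dg Dg]; split=> [x Ux|v].
  exact: differentiableD (df x Ux) (dg x Ux).
apply: Ck_ext (IH _ _ (Df v) (Dg v)) => // x Ux.
by rewrite -deriveD //; apply: diff_derivable; auto.
Qed.

Lemma CkM k U (f g : V -> R) : open U ->
  Ck k U f -> Ck k U g -> Ck k U (fun x => f x * g x).
Proof.
move=> oU; elim: k f g => [|k IH] f g /=.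
  by move=> cf cg x Ux; exact: cvgM (cf x Ux) (cg x Ux).
move=> [df Df] [dg Dg]; split=> [x Ux|v].
  exact: differentiableM (df x Ux) (dg x Ux).
have Cf : Ck k U f by exact: CkW.
have Cg : Ck k U g by exact: CkW.
apply: Ck_ext (CkD oU (IH _ _ Cf (Dg v)) (IH _ _ Cg (Df v))) => // x Ux.
by rewrite -[_ + _]/(_ *: _ + _ *: _) -deriveM //; apply: diff_derivable; auto.
Qed.

Lemma Ck_sum (W : normedModType R) (J : Type) (r : seq J) k U (f : J -> V ->
    W) : open U ->
  (forall j, Ck k U (f j)) -> Ck k U (fun x => \sum_(j <- r) f j x).
Proof.
move=> oU Cf; elim: r => [|j r IH].
  by apply: Ck_ext (Ck_cst k U 0) => // x _; rewrite big_nil.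
by apply: Ck_ext (CkD oU (Cf j) IH) => // x _; rewrite big_cons.
Qed.

Lemma Ck_scale (W : normedModType R) k U (f : V -> R) (w : W) : open U ->
  Ck k U f -> Ck k U (fun x => f x *: w).
Proof.
move=> oU; elim: k f => [|k IH] f.
  by move=> cf x Ux; apply: cvgZr_tmp; exact: cf.
move=> [df Df]; split=> [x Ux|v].
  by apply: differentiableZl => //; exact: df.
apply: Ck_ext (IH _ (Df v)) => // x Ux /=.
have dfx := df x Ux.
rewrite !deriveE //; last exact: differentiableZl.
by rewrite diffZl.
Qed.

Lemma Ck_mxE m n k U (f : V -> 'M[R]_(m, n)) : open U ->
  Ck k U f <-> forall i j, Ck k U (fun x => f x i j).
Proof.
move=> oU; split=> [Cf i j|Cf].
  elim: k f Cf => [|k IH] f Cf.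
    move=> x Ux; apply: (@continuous_comp _ _ _ f (fun M : 'M[R]_(m, n) =>
        M i j)); first exact: Cf.
    exact: coord_continuous.
  case: Cf => df Df; split=> [x Ux|v].
    apply: (@differentiable_comp _ _ _ _ f (fun M : 'M[R]_(m, n) => M i j));
        first exact: df.
    exact: differentiable_coord.
  apply: Ck_ext (IH _ (Df v)) => // x Ux.
  by rewrite derive_mx ?mxE//; exact/diff_derivable/df.
apply: (@Ck_ext _ k U (fun x => \sum_i \sum_j f x i j *: delta_mx i j)) => //.
  by move=> x _; rewrite -matrix_sum_delta.
do 2 (apply: Ck_sum => // ?).
exact: Ck_scale.
Qed.
End Ck.

(** * Symmetry of second derivatives *)

Section Schwarz.
Variables (R : realType) (V : normedModType R).

Lemma is_derive_line (W : normedModType R) (f : V -> W) (y u : V) (s : R) :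
  differentiable f (s *: u + y) ->
  is_derive s 1 (fun t : R => f (t *: u + y)) ('D_u f (s *: u + y)).
Proof.
move=> df.
have dl : differentiable (fun t : R => t *: u + y) s by [].
apply: DeriveDef.
  by apply/derivable1_diffP; apply: (@differentiable_comp _ _ _ _ (fun t : R =>
      t *: u + y) f).
rewrite deriveE; last exact: (@differentiable_comp _ _ _ _ (fun t : R => t *: u + y) f).
rewrite (@diff_comp _ _ _ _ (fun t : R => t *: u + y) f) //= deriveE //.
congr ('d f _ _).
rewrite diff_val. by rewrite !fctE /= scale1r addr0.
Qed.

(** The mean value theorem is applied twice, in the direction [u] to a difference of two values of
    [f] and then in the direction [v] to ['D_u f]. The left side is symmetric in [u] and [v], so the
    roles of the two vectors can be exchanged. *)
Lemma second_difference (U : set V) (f : V -> R) (x u v : V) (h : R) :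
  0 < h -> Ck 2 U f ->
  (forall s t : R, 0 <= s <= h -> 0 <= t <= h -> U (s *: u + (t *: v + x))) ->
  exists s t : R, [/\ 0 <= s <= h, 0 <= t <= h &
    f (h *: u + (h *: v + x)) - f (h *: u + x) - f (h *: v + x) + f x =
    h ^+ 2 * 'D_v ('D_u f) (s *: u + (t *: v + x))].
Proof.
move=> h0 [df Df] inU.
have hh : 0 <= h <= h by rewrite ltW/=.
have h00 : 0 <= (0 : R) <= h by rewrite lexx ltW.
have sub (s : R) : s \in `]0, h[ -> 0 <= s <= h.
  by rewrite in_itv/= => /andP[/ltW -> /ltW ->].
pose phi (s : R) := f (s *: u + (h *: v + x)) - f (s *: u + x).
have dphi (s : R) : 0 <= s <= h ->
    is_derive s 1 phi ('D_u f (s *: u + (h *: v + x)) - 'D_u f (s *: u + x)).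
  move=> hs; apply: is_deriveB.
    by apply: is_derive_line; apply: df; exact: inU.
  apply: is_derive_line; apply: df; have := inU s 0 hs h00.
  by rewrite scale0r add0r.
have [] := @MVT R phi _ 0 h h0 (fun s hs => dphi s (sub s hs)).
  apply: derivable_within_continuous => s; rewrite in_itv/= => hs.
  by have [] := dphi s hs.
move=> s; rewrite in_itv/= => /andP[/ltW s0 /ltW sh]; rewrite subr0 => E1.
have hs : 0 <= s <= h by rewrite s0.
pose psi (t : R) := 'D_u f (t *: v + (s *: u + x)).
have dpsi (t : R) : 0 <= t <= h ->
    is_derive t 1 psi ('D_v ('D_u f) (t *: v + (s *: u + x))).
  move=> ht; apply: is_derive_line; apply: (Df u).1.
  by rewrite addrCA; exact: inU.
have [] := @MVT R psi _ 0 h h0 (fun s hs => dpsi s (sub s hs)).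
  apply: derivable_within_continuous => t; rewrite in_itv/= => ht.
  by have [] := dpsi t ht.
move=> t; rewrite in_itv/= => /andP[/ltW t0 /ltW th]; rewrite subr0 => E2.
exists s, t; split=> //; first by rewrite t0.
rewrite [s *: u + _]addrCA.
have -> : f (h *: u + (h *: v + x)) - f (h *: u + x) - f (h *: v + x)
    + f x = phi h - phi 0.
  by rewrite /phi !scale0r !add0r; ring.
rewrite E1 [s *: u + (h *: v + x)]addrCA.
by move: E2; rewrite /psi !scale0r add0r => ->; ring.
Qed.

(** Both mixed derivatives, taken at suitable points near [x], equal the same second difference
    divided by [h ^+ 2]; their continuity at [x] does the rest. *)
Lemma derive_swap (U : set V) (f : V -> R) (x u v : V) : open U -> U x ->
  Ck 2 U f -> 'D_u ('D_v f) x = 'D_v ('D_u f) x.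
Proof.
move=> oU Ux Cf; apply/eqP; rewrite -subr_eq0 -normr_le0; apply/ler_addgt0Pl => e e0.
rewrite addr0.
have e20 : 0 < e / 2 by rewrite divr_gt0.
have near1 (a b : V) : \forall y \near x, `|'D_a ('D_b f) x - 'D_a ('D_b f) y| <= e / 2.
  by have /cvgrPdist_le /(_ _ e20) := ((Cf.2 b).2 a) x Ux.
have : \forall y \near x, [/\ U y, `|'D_u ('D_v f) x - 'D_u ('D_v f) y| <= e / 2 &
    `|'D_v ('D_u f) x - 'D_v ('D_u f) y| <= e / 2].
  have nU : \forall y \near x, U y by exact: open_nbhs_nbhs.
  by apply: filterS3 nU (near1 u v) (near1 v u).
move=> /nbhs_ballP[r /= r0 Hr].
(* This [h] keeps the whole parallelogram spanned by [h *: u] and [h *: v] at [x] in the ball of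
   radius [r]; the summand 1 covers [u = v = 0]. *)
set h := r / 2 / (`|u| + `|v| + 1).
have p0 : 0 < `|u| + `|v| + 1 by rewrite ltr_wpDl// addr_ge0.
have h0 : 0 < h by rewrite !divr_gt0.
have inB (s t : R) : 0 <= s <= h -> 0 <= t <= h -> ball x r (s *: u + (t *: v + x)).
  move=> /andP[s0 sh] /andP[t0 th].
  rewrite -ball_normE /ball_/= addrA opprD addrCA subrr addr0 normrN.
  apply: le_lt_trans (ler_normD _ _) _; rewrite !normrZ !ger0_norm//.
  apply: (@le_lt_trans _ _ (h * (`|u| + `|v| + 1))).
    rewrite !mulrDr mulr1 -[leLHS]addr0; apply: lerD; last exact: ltW.
    by apply: lerD; apply: ler_wpM2r.
  by rewrite divfK ?gt_eqF// ltr_pdivrMr// ltr_pMr// ltr1n.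
have [s1 [t1 [hs1 ht1 E1]]] := second_difference h0 Cf (fun s t hs ht =>
    let: And3 a _ _ := Hr _ (inB s t hs ht) in a).
have inB' (s t : R) : 0 <= s <= h -> 0 <= t <= h -> ball x r (s *: v + (t *: u + x)).
  by move=> hs ht; rewrite addrCA; exact: inB.
have [s2 [t2 [hs2 ht2 E2]]] := second_difference h0 Cf (fun s t hs ht =>
    let: And3 a _ _ := Hr _ (inB' s t hs ht) in a).
have E : 'D_v ('D_u f) (s1 *: u + (t1 *: v + x)) = 'D_u ('D_v f) (s2 *: v
    + (t2 *: u + x)).
  apply: (@mulfI _ (h ^+ 2)); first by rewrite expf_neq0// gt_eqF.
  apply: etrans (esym E1) (etrans _ E2).
  by rewrite (addrCA (h *: v)); ring.
have [_ _ A1] := Hr _ (inB _ _ hs1 ht1).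
have [_ A2 _] := Hr _ (inB' _ _ hs2 ht2).
rewrite -E in A2; rewrite [e]splitr.
move: A1 A2; set a := 'D_v ('D_u f) (_ + _) => A1 A2.
rewrite -(subrKA a); apply: le_trans (ler_normD _ _) _.
by apply: lerD; [exact: A2|rewrite distrC; exact: A1].
Qed.
End Schwarz.

(** * Partial derivatives and the chain rule *)

Section Coordinates.
Variables (R : realType) (n : nat).
Lemma derive_ebase (W : normedModType R) (f : 'rV[R]_n -> W) x v : differentiable f x ->
  'D_v f x = \sum_j v 0 j *: 'D_(ebase R j) f x.
Proof.
move=> df; rewrite deriveE// {1}[v]row_sum_delta linear_sum.
by apply: eq_bigr => j _; rewrite linearZ /= deriveE.
Qed.

(** By the chain rule a derivative of [f \o c] is a sum of products of derivatives of [c] with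
    partial derivatives of [f] composed with [c], and all of these are of class one less. *)
Lemma Ck_comp (V : normedModType R) k (U : set V) (U' : set 'rV[R]_n)
  (c : V -> 'rV[R]_n) (f : 'rV[R]_n -> R) : open U ->
  (forall x, U x -> U' (c x)) -> Ck k U c -> Ck k U' f -> Ck k U (f \o c).
Proof.
move=> oU UU'; elim: k f c UU' => [|k IH] f c UU' Cc Cf.
  by move=> x Ux; apply: continuous_comp; [exact: Cc|exact: Cf (UU' x Ux)].
have Cck : Ck k U c by exact: CkW.
case: Cc Cf => dc Dc [df Df]; split=> [x Ux|v].
  by apply: differentiable_comp; [exact: dc|exact/df/UU'].
apply: (@Ck_ext _ _ _ _ _ (fun x => \sum_j ('D_v c x) 0 j * ('D_(ebase R j) f \o
    c) x)) => //.
  move=> x Ux; have dfx := df _ (UU' x Ux); have dcx := dc x Ux.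
  apply: esym; rewrite (deriveE v (differentiable_comp dcx dfx)).
  rewrite (diff_comp dcx dfx) /= -(deriveE v dcx) -(deriveE _ dfx).
  by rewrite (derive_ebase _ dfx).
apply: Ck_sum => // j; apply: CkM => //; last first.
  exact: (IH ('D_(ebase R j) f) c UU' Cck (Df _)).
by move: (Dc v) => /(Ck_mxE _ _ oU)/(_ 0 j).
Qed.
End Coordinates.

Section Smooth.
Variables (R : realType) (V : normedModType R) (U : set V).
Hypothesis oU : open U.

Lemma smooth_ext (W : normedModType R) (f h : V -> W) :
  (forall x, U x -> f x = h x) -> smooth_on U f -> smooth_on U h.
Proof. by move=> fh sf k; exact: Ck_ext fh (sf k). Qed.

Lemma smooth_cst (W : normedModType R) (a : W) : smooth_on U (fun=> a).
Proof. by move=> k; exact: Ck_cst. Qed.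

Lemma smoothD (W : normedModType R) (f h : V -> W) :
  smooth_on U f -> smooth_on U h -> smooth_on U (fun x => f x + h x).
Proof. by move=> sf sh k; exact: CkD. Qed.

Lemma smoothM (f h : V -> R) :
  smooth_on U f -> smooth_on U h -> smooth_on U (fun x => f x * h x).
Proof. by move=> sf sh k; exact: CkM. Qed.

Lemma smooth_sum (W : normedModType R) (J : Type) (r : seq J) (f : J -> V -> W) :
  (forall j, smooth_on U (f j)) -> smooth_on U (fun x => \sum_(j <- r) f j x).
Proof. by move=> sf k; apply: Ck_sum => // j; exact: sf. Qed.

Lemma smooth_derive (W : normedModType R) (f : V -> W) v :
  smooth_on U f -> smooth_on U ('D_v f).
Proof. by move=> sf k; exact: (sf k.+1).2. Qed.

Lemma smooth_differentiable (W : normedModType R) (f : V -> W) x :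
  smooth_on U f -> U x -> differentiable f x.
Proof. by move=> sf; exact: (sf 1).1. Qed.

Lemma smooth_mxP m n (f : V -> 'M[R]_(m, n)) :
  smooth_on U f <-> forall i j, smooth_on U (fun x => f x i j).
Proof.
split=> [sf i j k|sf k]; first exact: (Ck_mxE k f oU).1.
by apply/(Ck_mxE k f oU) => i j; exact: sf.
Qed.

Lemma smooth_mulmx m n p (A : V -> 'M[R]_(m, n)) (B : V -> 'M[R]_(n, p)) :
  smooth_on U A -> smooth_on U B -> smooth_on U (fun x => A x *m B x).
Proof.
move=> /smooth_mxP sA /smooth_mxP sB; apply/smooth_mxP => i j.
apply: (@smooth_ext _ (fun x => \sum_k A x i k * B x k j)).
  by move=> x _; rewrite mxE.
by apply: smooth_sum => k; exact: smoothM.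
Qed.

Lemma smooth_tr m n (A : V -> 'M[R]_(m, n)) :
  smooth_on U A -> smooth_on U (fun x => (A x)^T).
Proof.
move=> /smooth_mxP sA; apply/smooth_mxP => i j.
by apply: smooth_ext (sA j i) => x _; rewrite mxE.
Qed.

Lemma smoothZ m n (f : V -> R) (A : V -> 'M[R]_(m, n)) :
  smooth_on U f -> smooth_on U A -> smooth_on U (fun x => f x *: A x).
Proof.
move=> sf /smooth_mxP sA; apply/smooth_mxP => i j.
by apply: smooth_ext (smoothM sf (sA i j)) => x _; rewrite mxE.
Qed.

Lemma smoothB m n (A B : V -> 'M[R]_(m, n)) :
  smooth_on U A -> smooth_on U B -> smooth_on U (fun x => A x - B x).
Proof.
move=> sA sB; apply: smoothD => //.
apply: (@smooth_ext _ (fun x => (-1) *: B x)) => [x _|]; first by rewrite scaleN1r.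
by apply: smoothZ => //; exact: smooth_cst.
Qed.

Lemma smooth_bilin n (G : V -> 'M[R]_n) (X Y : V -> 'rV[R]_n) :
  smooth_on U G -> smooth_on U X -> smooth_on U Y ->
  smooth_on U (fun x => bilin (G x) (X x) (Y x)).
Proof.
move=> sG sX sY; apply: (smooth_mxP (fun x => X x *m G x *m (Y x)^T)).1.
by apply: smooth_mulmx; [exact: smooth_mulmx|exact: smooth_tr].
Qed.
End Smooth.

(** * Covariant derivatives and curvature in a chart *)

Section Bilin.
Variables (R : realType) (n : nat) (G : 'M[R]_n).
Implicit Types u v w : 'rV[R]_n.
Lemma bilinDl u v w : bilin G (u + v) w = bilin G u w + bilin G v w.
Proof. by rewrite /bilin !mulmxDl mxE. Qed.
Lemma bilinDr u v w : bilin G u (v + w) = bilin G u v + bilin G u w.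
Proof. by rewrite /bilin linearD mulmxDr mxE. Qed.
Lemma bilinZl a v w : bilin G (a *: v) w = a * bilin G v w.
Proof. by rewrite /bilin -!scalemxAl mxE. Qed.
Lemma bilinZr a v w : bilin G v (a *: w) = a * bilin G v w.
Proof. by rewrite /bilin linearZ -scalemxAr mxE. Qed.
Lemma bilinNl v w : bilin G (- v) w = - bilin G v w.
Proof. by rewrite -scaleN1r bilinZl mulN1r. Qed.
Lemma bilinNr v w : bilin G v (- w) = - bilin G v w.
Proof. by rewrite -scaleN1r bilinZr mulN1r. Qed.
Lemma bilin0l v : bilin G 0 v = 0.
Proof. by rewrite -(scale0r 0) bilinZl mul0r. Qed.
Lemma bilin0r v : bilin G v 0 = 0.
Proof. by rewrite -(scale0r 0) bilinZr mul0r. Qed.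
Lemma bilinC u v : G^T = G -> bilin G u v = bilin G v u.
Proof.
move=> Gs; rewrite /bilin.
have -> : (u *m G *m v^T) 0 0 = (u *m G *m v^T)^T 0 0 by rewrite [RHS]mxE.
by rewrite !trmx_mul trmxK Gs mulmxA.
Qed.
End Bilin.

Section Christoffel.
Variables (R : realType) (n : nat) (C : 'I_n -> 'I_n -> 'rV[R]_n).
Implicit Types u v w : 'rV[R]_n.
Lemma christoffelDl u v w :
  christoffel C (u + v) w = christoffel C u w + christoffel C v w.
Proof.
rewrite /christoffel -big_split; apply: eq_bigr => k _ /=.
by rewrite -big_split; apply: eq_bigr => l _ /=; rewrite !mxE mulrDl scalerDl.
Qed.
Lemma christoffelDr u v w :
  christoffel C u (v + w) = christoffel C u v + christoffel C u w.
Proof.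
rewrite /christoffel -big_split; apply: eq_bigr => k _ /=.
by rewrite -big_split; apply: eq_bigr => l _ /=; rewrite !mxE mulrDr scalerDl.
Qed.
Lemma christoffelZl a v w : christoffel C (a *: v) w = a *: christoffel C v w.
Proof.
rewrite /christoffel scaler_sumr; apply: eq_bigr => k _ /=.
by rewrite scaler_sumr; apply: eq_bigr => l _ /=; rewrite mxE scalerA mulrA.
Qed.
Lemma christoffelZr a v w : christoffel C v (a *: w) = a *: christoffel C v w.
Proof.
rewrite /christoffel scaler_sumr; apply: eq_bigr => k _ /=.
by rewrite scaler_sumr; apply: eq_bigr => l _ /=; rewrite mxE scalerA mulrCA.
Qed.
Lemma christoffel0r w : christoffel C w 0 = 0.
Proof. by have := christoffelZr 0 w 0; rewrite !scale0r. Qed.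
End Christoffel.

(** * Tensoriality of the curvature *)

Section Connection.
Variables (R : realType) (n : nat).
Variables (U : set 'rV[R]_n) (Gam : 'rV[R]_n -> 'I_n -> 'I_n -> 'rV[R]_n).
Hypothesis oU : open U.
Hypothesis sGam : forall k l, smooth_on U (fun x => Gam x k l).
Local Notation field := (field R n).
Implicit Types (X Y Z : field) (x u v w : 'rV[R]_n).

(** Only the value at [x] of the differentiating field matters, so the direction is a single
    vector. *)
Definition cov x v Y := 'D_v Y x + christoffel (Gam x) v (Y x).

Lemma nablaE X Y x : nabla Gam X Y x = cov x (X x) Y.
Proof. by []. Qed.

Lemma cov_near x v Y Z : (\near x, Y x = Z x) -> cov x v Y = cov x v Z.
Proof.
by move=> YZ; rewrite /cov (near_eq_derive _ YZ) (nbhs_singleton YZ).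
Qed.

Lemma cov_eq x v Y Z : U x -> (forall y, U y -> Y y = Z y) -> cov x v Y = cov x v Z.
Proof. by move=> Ux YZ; apply: cov_near; exact: eq_on_near YZ Ux. Qed.

Lemma covD x v Y Z : differentiable Y x -> differentiable Z x ->
  cov x v (fun y => Y y + Z y) = cov x v Y + cov x v Z.
Proof.
move=> dY dZ; rewrite /cov christoffelDr.
have -> : 'D_v (fun y => Y y + Z y) x = 'D_v Y x + 'D_v Z x.
  by rewrite -deriveD //; exact: diff_derivable.
by rewrite addrACA.
Qed.

Lemma cov_cst0 x v : cov x v (fun=> 0) = 0.
Proof. by rewrite /cov derive_cst christoffel0r addr0. Qed.

Lemma covZ x v (f : 'rV[R]_n -> R) Y : differentiable f x -> differentiable Y x ->
  cov x v (fun y => f y *: Y y) = 'D_v f x *: Y x + f x *: cov x v Y.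
Proof.
move=> df dY; rewrite /cov christoffelZr scalerDr addrA; congr (_ + _).
have dfi := @diff_derivable _ _ _ _ _ v df.
have dYi := @diff_derivable _ _ _ _ _ v dY.
have M i j : (fun y => (f y *: Y y) i j) = f * (fun y => Y y i j).
  by apply/funext => y; rewrite mxE.
have dYij i j : derivable (fun y => Y y i j) x v.
  exact: ((derivable_mxP Y x v).1 dYi i j).
have D : derivable (fun y => f y *: Y y) x v.
  apply: (derivable_mxP _ x v).2 => i j; rewrite M.
  exact: derivableM dfi (dYij i j).
rewrite (derive_mx D) (derive_mx dYi); apply/matrixP => i j; rewrite !mxE M.
rewrite (deriveM dfi (dYij i j)) addrC; congr (_ + _); exact: mulrC.
Qed.

Lemma covN x v Y : differentiable Y x -> cov x v (fun y => - Y y) = - cov x v Y.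
Proof.
move=> dY; have := @covZ x v (cst (-1)) Y (differentiable_cst _ _) dY.
rewrite derive_cst scale0r add0r scaleN1r => <-.
by congr cov; apply/funext => y; rewrite scaleN1r.
Qed.

Lemma covB x v Y Z : differentiable Y x -> differentiable Z x ->
  cov x v (fun y => Y y - Z y) = cov x v Y - cov x v Z.
Proof. by move=> dY dZ; rewrite -covN// covD//; exact: differentiableN. Qed.

Lemma differentiable_scale (f : 'rV[R]_n -> R) Y x : differentiable f x ->
    differentiable Y x ->
  differentiable (fun y => f y *: Y y) x.
Proof.
move=> df dY.
have -> : (fun y => f y *: Y y) = \sum_j (fun y => (f y * Y y 0 j) *: delta_mx 0 j).
  apply/funext => y; rewrite fct_sumE {1}[Y y]row_sum_delta scaler_sumr.
  by apply: eq_bigr => j _; rewrite scalerA.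
apply: differentiable_sum => j; apply: differentiableZl.
apply: differentiableM => //.
apply: (@differentiable_comp _ _ _ _ Y (fun M : 'rV[R]_n => M 0 j)) => //.
exact: differentiable_coord.
Qed.

Lemma cov_sum m x v (Y : 'I_m -> field) :
  (forall j, differentiable (Y j) x) ->
  cov x v (fun y => \sum_j Y j y) = \sum_j cov x v (Y j).
Proof.
elim: m Y => [|m IH] Y dY.
  rewrite big_ord0 -[RHS](cov_cst0 x v); congr cov.
  by apply/funext => y; rewrite big_ord0.
rewrite big_ord_recl -IH// -covD//; last first.
  have -> : (fun y => \sum_(j < m) Y (lift ord0 j) y) = \sum_(j < m) Y (lift ord0 j).
    by apply/funext => y; rewrite fct_sumE.
  exact: differentiable_sum.
by congr cov; apply/funext => y; rewrite big_ord_recl.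
Qed.

Lemma covDl x u v Y : differentiable Y x -> cov x (u + v) Y = cov x u Y + cov x v Y.
Proof. by move=> dY; rewrite /cov !deriveE// linearD christoffelDl addrACA. Qed.

Lemma covZl x a v Y : differentiable Y x -> cov x (a *: v) Y = a *: cov x v Y.
Proof. by move=> dY; rewrite /cov !deriveE// linearZ christoffelZl scalerDr. Qed.

Lemma cov_suml (J : finType) x (v : J -> 'rV[R]_n) Y : differentiable Y x ->
  cov x (\sum_j v j) Y = \sum_j cov x (v j) Y.
Proof.
move=> dY; apply: (big_morph (fun v => cov x v Y)) => [u w|]; first exact: covDl.
by have := covZl 0 0 dY; rewrite !scale0r.
Qed.

Lemma smooth_coord X j : smooth_on U X -> smooth_on U (fun x => X x 0 j).
Proof. by move=> /(smooth_mxP oU). Qed.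

Lemma smooth_christoffel X Y : smooth_on U X -> smooth_on U Y ->
  smooth_on U (fun x => christoffel (Gam x) (X x) (Y x)).
Proof.
move=> sX sY; apply: smooth_sum => // k; apply: smooth_sum => // l.
apply: smoothZ => //; apply: smoothM => //; exact: smooth_coord.
Qed.

Lemma smooth_derive_field X Y : smooth_on U X -> smooth_on U Y ->
  smooth_on U (fun x => 'D_(X x) Y x).
Proof.
move=> sX sY.
apply: (@smooth_ext _ _ _ oU _ (fun x => \sum_j X x 0 j *: 'D_(ebase R j) Y x)).
  by move=> x Ux; rewrite [RHS]derive_ebase//; exact: smooth_differentiable Ux.
apply: smooth_sum => // j; apply: smoothZ => //; last exact: smooth_derive.
exact: smooth_coord.
Qed.

Lemma smooth_nabla X Y : smooth_on U X -> smooth_on U Y -> smooth_on U (nabla Gam X Y).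
Proof.
move=> sX sY; apply: smoothD => //; last exact: smooth_christoffel.
exact: smooth_derive_field.
Qed.

Let sd X x : smooth_on U X -> U x -> differentiable X x.
Proof. exact: smooth_differentiable. Qed.

Definition nabla_cst v Y : field := nabla Gam (fun=> v) Y.

Lemma nabla_cstE v Y x : nabla_cst v Y x = cov x v Y. Proof. by []. Qed.

Lemma smooth_nabla_cst v Y : smooth_on U Y -> smooth_on U (nabla_cst v Y).
Proof. by move=> sY; apply: smooth_nabla => //; exact: smooth_cst. Qed.

Lemma nabla_coord X Y x : differentiable Y x ->
  nabla Gam X Y x = \sum_j X x 0 j *: nabla_cst (ebase R j) Y x.
Proof.
move=> dY; rewrite nablaE {1}[X x]row_sum_delta cov_suml//.
by apply: eq_bigr => j _; rewrite covZl.
Qed.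

Lemma derive_coord X x v j : differentiable X x ->
  'D_v (fun y => X y 0 j) x = 'D_v X x 0 j.
Proof.
by move=> dX; rewrite [in RHS](derive_mx (diff_derivable dX)) mxE.
Qed.

(** A Leibniz rule that separates the variation of [Y] from the second derivative of [Z] taken with
    [Y] frozen at its value. The coordinate expansion is used for [Y] and for the constant field
    [Y x]; they differ only in the term with ['D_u Y x]. *)
Lemma cov_nabla x u Y Z : U x -> smooth_on U Y -> smooth_on U Z ->
  cov x u (nabla Gam Y Z) = cov x ('D_u Y x) Z + cov x u (nabla_cst (Y x) Z).
Proof.
move=> Ux sY sZ; have dZ y (Uy : U y) := sd sZ Uy.
have H W : smooth_on U W -> cov x u (nabla Gam W Z) =
    cov x ('D_u W x) Z + \sum_j W x 0 j *: cov x u (nabla_cst (ebase R j) Z).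
  move=> sW; rewrite (@cov_eq x u _ (fun y => \sum_j W y 0 j *: nabla_cst (ebase
      R j) Z y))//; last first.
    by move=> y Uy; exact/nabla_coord/dZ.
  have dn j : differentiable (nabla_cst (ebase R j) Z) x by exact: sd
      (smooth_nabla_cst _ _) Ux.
  have dW j : differentiable (fun y => W y 0 j) x.
    exact: smooth_differentiable (smooth_coord j sW) Ux.
  rewrite cov_sum; last by move=> j; exact: differentiable_scale.
  have -> : cov x ('D_u W x) Z = \sum_j 'D_u W x 0 j *: nabla_cst (ebase R j) Z x.
    by rewrite -(nabla_coord (fun=> 'D_u W x))//; exact: dZ.
  rewrite -big_split; apply: eq_bigr => j _ /=.
  by rewrite covZ// derive_coord//; exact: sd Ux.
rewrite (H Y)//; congr (_ + _).
have sc : smooth_on U (fun=> Y x) by exact: smooth_cst.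
rewrite [RHS](H _ sc) derive_cst.
by have := covZl 0 0 (dZ x Ux); rewrite !scale0r => ->; rewrite add0r.
Qed.

(** The curvature on constant fields [u] and [v], whose Lie bracket vanishes. *)
Definition riem x u v Z := cov x u (nabla_cst v Z) - cov x v (nabla_cst u Z).

(** The terms by which [cov_nabla] accounts for the variation of [X] and [Y] add up to the bracket
    term. *)
Lemma curvature_riem X Y Z x : U x -> smooth_on U X -> smooth_on U Y -> smooth_on U Z ->
  curvature Gam X Y Z x = riem x (X x) (Y x) Z.
Proof.
move=> Ux sX sY sZ; have dZ := sd sZ Ux.
have E1 : nabla Gam X (nabla Gam Y Z) x =
  cov x ('D_(X x) Y x) Z + cov x (X x) (nabla_cst (Y x) Z) := cov_nabla (X x) Ux sY sZ.
have E2 : nabla Gam Y (nabla Gam X Z) x =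
  cov x ('D_(Y x) X x) Z + cov x (Y x) (nabla_cst (X x) Z) := cov_nabla (Y x) Ux sX sZ.
have E3 : nabla Gam (lie_bracket X Y) Z x =
    cov x ('D_(X x) Y x) Z - cov x ('D_(Y x) X x) Z.
  rewrite -[- _]scaleN1r -(covZl (-1) _ dZ) -(covDl _ _ dZ) scaleN1r.
  by [].
rewrite /curvature E1 E2 E3 /riem.
have E (a b c d : 'rV[R]_n) : a + b - (c + d) - (a - c) = b - d.
  by apply/rowP => j; rewrite !mxE; ring.
exact: E.
Qed.

(** The products of first derivatives are symmetric in [u] and [v], and so are the second
    derivatives of the components of [Z], by [derive_swap]; only the undifferentiated components
    survive. *)
Lemma riem_coord x u v Z : U x -> smooth_on U Z ->
  riem x u v Z = \sum_m Z x 0 m *: riem x u v (fun=> ebase R m).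
Proof.
move=> Ux sZ.
have dz m y : U y -> differentiable (fun y => Z y 0 m) y.
  exact/smooth_differentiable/smooth_coord.
have ce m : smooth_on U (fun=> ebase R m) by exact: smooth_cst.
have dn m w : differentiable (nabla_cst w (fun=> ebase R m)) x.
  by apply: (sd _ Ux); apply: smooth_nabla_cst; exact: ce.
have dD m w : differentiable ('D_w (fun y => Z y 0 m)) x.
  exact: smooth_differentiable (smooth_derive _ (smooth_coord m sZ)) Ux.
have H u' v' : cov x u' (nabla_cst v' Z) = \sum_m
   ('D_u' ('D_v' (fun y => Z y 0 m)) x *: ebase R m
    + 'D_v' (fun y => Z y 0 m) x *: cov x u' (fun=> ebase R m)
    + ('D_u' (fun y => Z y 0 m) x *: cov x v' (fun=> ebase R m)
    + Z x 0 m *: cov x u' (nabla_cst v' (fun=> ebase R m)))).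
  have E y : U y -> nabla_cst v' Z y = \sum_m ('D_v' (fun y => Z y 0 m) y *: ebase R m
      + Z y 0 m *: nabla_cst v' (fun=> ebase R m) y).
    move=> Uy; rewrite nabla_cstE (@cov_eq y v' _ (fun y =>
        \sum_m Z y 0 m *: ebase R m) Uy); last first.
      by move=> z _; rewrite [LHS]row_sum_delta.
    rewrite cov_sum; last first.
      by move=> m; apply: differentiable_scale; [exact: dz|exact: differentiable_cst].
    apply: eq_bigr => m _; rewrite covZ//; exact: dz.
  rewrite (cov_eq u' Ux E).
  have d1 m : differentiable (fun y => 'D_v' (fun y => Z y 0 m) y *: ebase R m) x.
    by apply: differentiable_scale => //; exact: dD.
  have d2 m : differentiable (fun y => Z y 0 m *: nabla_cst v' (fun=> ebase R m) y) x.
    by apply: differentiable_scale; [exact: dz|exact: dn].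
  rewrite cov_sum; last by move=> m; exact: differentiableD.
  apply: eq_bigr => m _; rewrite (covD _ (d1 m) (d2 m)); congr (_ + _).
    by rewrite covZ//; exact: dD.
  by rewrite covZ//; exact: dz.
rewrite /riem (H u v) (H v u) -sumrB; apply: eq_bigr => m _.
rewrite (derive_swap u v oU Ux (smooth_coord m sZ 2)).
rewrite scalerBr.
have E (a b c d e f : 'rV[R]_n) : a + b + (c + d) - (a + c + (b + f)) = d - f.
  by apply/rowP => j; rewrite !mxE; ring.
exact: E.
Qed.

Lemma curvature_at_riem x u v w : U x -> curvature_at Gam x u v w = riem x u v
    (fun=> w).
Proof.
move=> Ux; have sc (z : 'rV[R]_n) : smooth_on U (fun=> z) by exact: smooth_cst.
exact: curvature_riem Ux (sc u) (sc v) (sc w).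
Qed.

Lemma riemE x u v Z : U x -> smooth_on U Z -> riem x u v Z = curvature_at Gam x
    u v (Z x).
Proof.
move=> Ux sZ; have sc : smooth_on U (fun=> Z x) by exact: smooth_cst.
by rewrite (curvature_at_riem u v _ Ux) (riem_coord u v Ux sZ) [RHS](riem_coord
    u v Ux sc).
Qed.

Lemma curvatureE X Y Z x : U x -> smooth_on U X -> smooth_on U Y -> smooth_on U Z ->
  curvature Gam X Y Z x = curvature_at Gam x (X x) (Y x) (Z x).
Proof. by move=> Ux sX sY sZ; rewrite (curvature_riem Ux sX sY sZ)
    (riemE _ _ Ux sZ). Qed.
End Connection.

(** * Symmetries of the curvature tensor and the Bianchi identities *)

Section Riemann.
#[local] Opaque curvature_at cov bilin.
Variables (R : realType) (n : nat).
Variables (U : set 'rV[R]_n) (Gam : 'rV[R]_n -> 'I_n -> 'I_n -> 'rV[R]_n).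
Hypothesis oU : open U.
Hypothesis sGam : forall k l, smooth_on U (fun x => Gam x k l).
Implicit Types (X Y Z : field R n) (x u v w : 'rV[R]_n).
Local Notation rm := (curvature_at Gam).

Let sc w : smooth_on U (fun _ : 'rV[R]_n => w).
Proof. exact: smooth_cst. Qed.

Let sd X x : smooth_on U X -> U x -> differentiable X x.
Proof. exact: smooth_differentiable. Qed.

Let sn v Y : smooth_on U Y -> smooth_on U (nabla_cst Gam v Y).
Proof. exact: smooth_nabla_cst. Qed.

Lemma curvature_at_skew x u v w : U x -> rm x u v w = - rm x v u w.
Proof.
move=> Ux; rewrite (curvature_at_riem oU sGam u v w Ux).
by rewrite (curvature_at_riem oU sGam v u w Ux) /riem opprB.
Qed.

Lemma curvature_atDl x u u' v w : U x -> rm x (u + u') v w = rm x u v w + rm x u' v w.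
Proof.
move=> Ux; rewrite (curvature_at_riem oU sGam (u + u') v w Ux).
rewrite (curvature_at_riem oU sGam u v w Ux) (curvature_at_riem oU sGam u' v w Ux).
have dW z := sd (sn z (sc w)) Ux.
rewrite /riem (covDl _ u u' (dW v)).
have -> : cov Gam x v (nabla_cst Gam (u + u') (fun=> w)) =
    cov Gam x v (fun y => nabla_cst Gam u (fun=> w) y + nabla_cst Gam u' (fun=> w) y).
  apply: (@cov_eq _ _ U _ oU _ v _ _ Ux) => y Uy; exact: covDl (sd (sc w) Uy).
by rewrite (covD _ v (dW u) (dW u')) opprD addrACA.
Qed.

Lemma curvature_atZl x a u v w : U x -> rm x (a *: u) v w = a *: rm x u v w.
Proof.
move=> Ux; rewrite (curvature_at_riem oU sGam (a *: u) v w Ux).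
rewrite (curvature_at_riem oU sGam u v w Ux).
have dW z := sd (sn z (sc w)) Ux.
rewrite /riem (covZl _ a u (dW v)).
have -> : cov Gam x v (nabla_cst Gam (a *: u) (fun=> w)) =
    cov Gam x v (fun y => cst a y *: nabla_cst Gam u (fun=> w) y).
  apply: (@cov_eq _ _ U _ oU _ v _ _ Ux) => y Uy; exact: covZl (sd (sc w) Uy).
rewrite (covZ _ v (differentiable_cst _ _) (dW u)) derive_cst scale0r add0r.
by rewrite scalerBr.
Qed.

Lemma curvature_atZm x a u v w : U x -> rm x u (a *: v) w = a *: rm x u v w.
Proof.
move=> Ux; rewrite (curvature_at_skew u (a *: v) w Ux) (curvature_atZl a v u w Ux).
by rewrite (curvature_at_skew v u w Ux) scalerN opprK.
Qed.

Lemma curvature_at_coord x u v w : U x ->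
  rm x u v w = \sum_m w 0 m *: rm x u v (ebase R m).
Proof.
move=> Ux; rewrite (curvature_at_riem oU sGam u v w Ux).
rewrite (riem_coord oU sGam u v Ux (sc w)); apply: eq_bigr => m _.
by rewrite (curvature_at_riem oU sGam u v _ Ux).
Qed.

Lemma curvature_atDr x u v w w' : U x -> rm x u v (w + w') = rm x u v w + rm x u v w'.
Proof.
move=> Ux; rewrite (curvature_at_coord u v (w + w') Ux) (curvature_at_coord u v w Ux).
rewrite (curvature_at_coord u v w' Ux) -big_split; apply: eq_bigr => m _.
by rewrite mxE scalerDl.
Qed.

Lemma curvature_atZr x a u v w : U x -> rm x u v (a *: w) = a *: rm x u v w.
Proof.
move=> Ux; rewrite (curvature_at_coord u v (a *: w) Ux) (curvature_at_coord u v w Ux).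
rewrite scaler_sumr; apply: eq_bigr => m _.
by rewrite mxE scalerA.
Qed.

Lemma smooth_curvature_at u v w : smooth_on U (fun x => rm x u v w).
Proof.
apply: (@smooth_ext _ _ _ oU _ (fun x => cov Gam x u (nabla_cst Gam v (fun=>
    w)) - cov Gam x v (nabla_cst Gam u (fun=> w)))).
  by move=> x Ux; rewrite (curvature_at_riem oU sGam u v w Ux).
have := smoothB oU (sn u (sn v (sc w))) (sn v (sn u (sc w))).
exact.
Qed.

(** Symmetric Christoffel symbols give nabla_b c = nabla_c b for constant fields, and the six second
    derivatives cancel in pairs. *)
Lemma bianchi1 x u v w : U x ->
  (forall y a b, U y -> christoffel (Gam y) a b = christoffel (Gam y) b a) ->
  rm x u v w + rm x v w u + rm x w u v = 0.
Proof.
move=> Ux tf.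
rewrite (curvature_at_riem oU sGam u v w Ux) (curvature_at_riem oU sGam v w u Ux).
rewrite (curvature_at_riem oU sGam w u v Ux) /riem.
have E a b c : cov Gam x a (nabla_cst Gam b (fun=>
    c)) = cov Gam x a (nabla_cst Gam c (fun=> b)).
  apply: (@cov_eq _ _ U _ oU _ a _ _ Ux) => y Uy.
  by rewrite /nabla_cst /nabla !derive_cst (tf y _ _ Uy).
rewrite (E u w v) (E v u w) (E w v u).
have F (a b c : 'rV[R]_n) : a - b + (b - c) + (c - a) = 0.
  by apply/rowP => j; rewrite !mxE; ring.
exact: F.
Qed.

(** This is the Jacobi identity for the operators nabla_u, nabla_v, nabla_w attached to constant
    fields, applied to the constant field [z]. *)
Lemma bianchi2 x u v w z : U x ->
  cov Gam x w (fun y => rm y u v z) - rm x u v (cov Gam x w (fun=> z)) +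
  (cov Gam x u (fun y => rm y v w z) - rm x v w (cov Gam x u (fun=> z))) +
  (cov Gam x v (fun y => rm y w u z) - rm x w u (cov Gam x v (fun=> z))) = 0.
Proof.
move=> Ux.
have dW a b := sd (sn a (sn b (sc z))) Ux.
have E a b c : cov Gam x c (fun y => rm y a b z) =
    cov Gam x c (nabla_cst Gam a (nabla_cst Gam b (fun=>
        z))) - cov Gam x c (nabla_cst Gam b (nabla_cst Gam a (fun=> z))).
  rewrite -(covB _ c (dW a b) (dW b a)); apply: (@cov_eq _ _ U _ oU _ c _ _ Ux) => y Uy.
  by rewrite (curvature_at_riem oU sGam a b z Uy).
(* Tensoriality: the vector nabla_c z at [x] may be extended by the field nabla_c z itself rather
   than by a constant one, which makes third derivatives appear. *)
have F a b c : rm x a b (cov Gam x c (fun=> z)) =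
    cov Gam x a (nabla_cst Gam b (nabla_cst Gam c (fun=>
        z))) - cov Gam x b (nabla_cst Gam a (nabla_cst Gam c (fun=> z))).
  by rewrite -(riemE oU sGam a b Ux (sn c (sc z))).
rewrite !E !F.
have G (a b c d e f : 'rV[R]_n) :
  a - b - (c - d) + (c - e - (f - b)) + (f - d - (a - e)) = 0.
  by apply/rowP => j; rewrite !mxE; ring.
exact: G.
Qed.

Variable g : 'rV[R]_n -> 'M[R]_n.
Hypothesis sg : smooth_on U g.
Hypothesis gC : forall x, U x -> (g x)^T = g x.
Hypothesis compat : forall Y Z x v, U x -> smooth_on U Y -> smooth_on U Z ->
  'D_v (fun z => bilin (g z) (Y z) (Z z)) x =
  bilin (g x) (cov Gam x v Y) (Z x) + bilin (g x) (Y x) (cov Gam x v Z).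

(** The derivatives along [u] and [v] of the function g(w, z) commute; expanding both orders by
    metric compatibility leaves the two curvature terms. *)
Lemma curvature_at_metric_skew x u v w z : U x ->
  bilin (g x) (rm x u v w) z = - bilin (g x) (rm x u v z) w.
Proof.
move=> Ux.
have H a b : 'D_a ('D_b (fun y => bilin (g y) w z)) x =
   bilin (g x) (cov Gam x a (nabla_cst Gam b (fun=> w))) z + bilin (g x)
       (cov Gam x b (fun=> w)) (cov Gam x a (fun=> z))
   + (bilin (g x) (cov Gam x a (fun=> w)) (cov Gam x b (fun=> z))
       + bilin (g x) w (cov Gam x a (nabla_cst Gam b (fun=> z)))).
  have -> : 'D_a ('D_b (fun y => bilin (g y) w z)) x =
      'D_a ((fun y => bilin (g y) (nabla_cst Gam b (fun=> w) y) z) + (fun y =>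
          bilin (g y) w (nabla_cst Gam b (fun=> z) y))) x.
    apply: near_eq_derive; apply: eq_on_near Ux => // y Uy.
    exact: compat Uy (sc w) (sc z).
  have D1 Y Z : smooth_on U Y -> smooth_on U Z -> derivable (fun y =>
      bilin (g y) (Y y) (Z y)) x a.
    move=> sY sZ; apply: diff_derivable.
    exact: smooth_differentiable (smooth_bilin oU sg sY sZ) Ux.
  rewrite (deriveD (D1 _ _ (sn b (sc w)) (sc z)) (D1 _ _ (sc w) (sn b (sc z)))).
  by rewrite (compat a Ux (sn b (sc w)) (sc z)) (compat a Ux (sc w) (sn b (sc z))).
have S : 'D_u ('D_v (fun y => bilin (g y) w z)) x = 'D_v ('D_u (fun y =>
    bilin (g y) w z)) x.
  exact: derive_swap oU Ux (smooth_bilin oU sg (sc w) (sc z) 2).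
rewrite (H u v) (H v u) in S.
rewrite (bilinC _ w (gC Ux)) (curvature_at_riem oU sGam u v w Ux)
    (curvature_at_riem oU sGam u v z Ux).
rewrite /riem bilinDl bilinNl bilinDr bilinNr; move: S.
set a := bilin _ _ _; set b := bilin _ _ _; set c := bilin _ _ _; set d := bilin _ _ _.
set e := bilin _ _ _; set f := bilin _ _ _.
move: a b c d e f => a b c d e f; lra.
Qed.
End Riemann.

(** * Algebra of a tangent space of an LP-Sasakian manifold *)

Section Tangent.
Variables (R : realType) (G phi : 'M[R]_4) (xi : 'rV[R]_4) (eta : 'cV[R]_4).
Implicit Types (u v w x y z X Y Z W : 'rV[R]_4) (a b c : R).
Local Notation g := (bilin G).
Local Notation e := (form1 eta).

Hypothesis GC : G^T = G.
Hypothesis Gu : G \in unitmx.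
Hypothesis e_xi : e xi = -1.
Hypothesis phi2 : forall u, u *m phi *m phi = u + e u *: xi.
Hypothesis g_phi : forall u v, g (u *m phi) (v *m phi) = g u v + e u * e v.

Lemma form1D u v : e (u + v) = e u + e v.
Proof. by rewrite /form1 mulmxDl mxE. Qed.
Lemma form1Z a u : e (a *: u) = a * e u.
Proof. by rewrite /form1 -scalemxAl mxE. Qed.
Lemma form10 : e 0 = 0.
Proof. by rewrite -(scale0r 0) form1Z mul0r. Qed.

Lemma bilin_nondeg u : (forall v, g u v = 0) -> u = 0.
Proof.
move=> gu0; have uG : u *m G = 0.
  apply/rowP => j; have := gu0 (delta_mx 0 j).
  rewrite /bilin trmx_delta mxE (bigD1 j)//= big1 => [|k kj].
    by rewrite !mxE !eqxx mulr1 addr0.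
  by rewrite !mxE (negbTE kj) mulr0.
by rewrite -(mulmxK Gu u) uG mul0mx.
Qed.

(** As [phi^2 xi = 0], the formula for [phi^2] applied to [phi xi] makes [phi xi] a multiple [c xi],
    and then [c^2 xi = 0]. *)
Lemma phi_xi : xi *m phi = 0.
Proof.
have xi0 : xi != 0.
  by apply/eqP => xi0; have := e_xi; rewrite xi0 form10 => /eqP;
      rewrite eq_sym oppr_eq0 oner_eq0.
have p2 : xi *m phi *m phi = 0 by rewrite phi2 e_xi scaleN1r subrr.
have p3 : xi *m phi = - e (xi *m phi) *: xi.
  have := phi2 (xi *m phi); rewrite p2 mul0mx scaleNr => /eqP.
  by rewrite eq_sym addr_eq0 => /eqP.
move: p3; set c := - _ => p3; have := p2; rewrite p3 -scalemxAl p3 scalerA => /eqP.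
by rewrite scaler_eq0 (negbTE xi0) orbF mulf_eq0 orbb => /eqP ->; rewrite scale0r.
Qed.

Lemma bilin_xi u : g u xi = e u.
Proof.
have := g_phi u xi; rewrite phi_xi bilin0r e_xi => /esym/eqP.
by rewrite mulrN1 subr_eq0 => /eqP.
Qed.

(** Computing [phi^3 u] as [phi (phi^2 u)] and as [phi^2 (phi u)] gives results that differ by
    [eta(phi u) xi]. *)
Lemma form1_phi u : e (u *m phi) = 0.
Proof.
have E : u *m phi *m phi *m phi = u *m phi.
  by rewrite (phi2 u) mulmxDl -scalemxAl phi_xi scaler0 addr0.
have := phi2 (u *m phi); rewrite E => /esym/eqP.
rewrite -subr_eq0 addrC addKr => /eqP/(congr1 e).
by rewrite form1Z e_xi form10 mulrN1 => /eqP; rewrite oppr_eq0 => /eqP.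
Qed.

(* [hmet] is the metric of the distribution orthogonal to [xi] and [hproj] the
   projection onto it; [wedge] is the curvature tensor of constant curvature 1. *)
Definition hproj u := u + e u *: xi.
Definition hmet u v := g u v + e u * e v.
Definition wedge x y z := g y z *: x - g x z *: y.
Definition hwedge x y z := hmet y z *: hproj x - hmet x z *: hproj y.

Lemma form1_hproj u : e (hproj u) = 0.
Proof. by rewrite /hproj form1D form1Z e_xi mulrN1 subrr. Qed.

Lemma hproj_id u : e u = 0 -> hproj u = u.
Proof. by rewrite /hproj => ->; rewrite scale0r addr0. Qed.

Lemma hprojK u : u = hproj u - e u *: xi.
Proof. by rewrite /hproj addrK. Qed.

(** The trace of the endomorphism [x |-> l(x) u]. Every trace of a curvature identity below reduces
    to traces of this kind and to those of the identity, of the projection, of [phi] and of the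
    Ricci operator. *)
Lemma contract_linear (l : 'rV[R]_4 -> R) u : (forall v w, l (v + w) = l v + l w) ->
  (forall a v, l (a *: v) = a * l v) -> \sum_(k < 4) l (ebase R k) * u 0 k = l u.
Proof.
move=> lD lZ; rewrite {2}[u]row_sum_delta.
have l0 : l 0 = 0 by rewrite -(scale0r 0) lZ mul0r.
rewrite (big_morph l lD l0); apply: eq_bigr => k _.
by rewrite lZ mulrC.
Qed.

Lemma ebaseE (k : 'I_4) : ebase R k 0 k = 1.
Proof. by rewrite mxE !eqxx. Qed.

Lemma sum_ebase : \sum_(k < 4) ebase R k 0 k = 4 :> R.
Proof. by rewrite (eq_bigr (fun=> 1)) ?sumr_const ?card_ord// => k _;
    rewrite ebaseE. Qed.

Lemma contract_form1 u : \sum_(k < 4) e (ebase R k) * u 0 k = e u.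
Proof. by apply: contract_linear => *; rewrite (form1D, form1Z). Qed.

Lemma contract_bilin u z : \sum_(k < 4) g (ebase R k) z * u 0 k = g u z.
Proof. by apply: (@contract_linear (fun v => g v z)) => *; rewrite (bilinDl,
    bilinZl). Qed.

Lemma contract_hmet u z : \sum_(k < 4) hmet (ebase R k) z * u 0 k = hmet u z.
Proof.
apply: (@contract_linear (fun v => hmet v z)) => [v w|a v]; rewrite /hmet.
  by rewrite bilinDl form1D; ring.
by rewrite bilinZl form1Z; ring.
Qed.

Lemma contract_hproj : \sum_(k < 4) hproj (ebase R k) 0 k = 3 :> R.
Proof.
transitivity (\sum_(k < 4) (ebase R k 0 k + e (ebase R k) * xi 0 k)).
  by apply: eq_bigr => k _; rewrite !mxE.
by rewrite big_split/= sum_ebase contract_form1 e_xi; ring.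
Qed.

(** * Curvature tensors determined by their Ricci tensor, in one tangent space *)

Section CurvatureAlgebra.
Variable Rm : 'rV[R]_4 -> 'rV[R]_4 -> 'rV[R]_4 -> 'rV[R]_4.
Hypothesis RmDl : forall x x' y z, Rm (x + x') y z = Rm x y z + Rm x' y z.
Hypothesis RmZl : forall a x y z, Rm (a *: x) y z = a *: Rm x y z.
Hypothesis RmDr : forall x y z z', Rm x y (z + z') = Rm x y z + Rm x y z'.
Hypothesis RmZr : forall a x y z, Rm x y (a *: z) = a *: Rm x y z.
Hypothesis RmC : forall x y z, Rm x y z = - Rm y x z.
Hypothesis Rm_bianchi : forall x y z, Rm x y z + Rm y z x + Rm z x y = 0.
Hypothesis Rm_skew : forall x y z w, g (Rm x y z) w = - g (Rm x y w) z.
Hypothesis Rm_xi : forall x y, Rm x y xi = e y *: x - e x *: y.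

Lemma Rm_pair x y z w : g (Rm x y z) w = g (Rm z w x) y.
Proof.
pose F x y z w := g (Rm x y z) w.
have B (a b c d : 'rV[R]_4) : F a b c d + F b c a d + F c a b d = 0.
  by rewrite /F -!bilinDl Rm_bianchi bilin0l.
have S1 (a b c d : 'rV[R]_4) : F a b c d = - F b a c d by rewrite /F RmC bilinNl.
have S2 (a b c d : 'rV[R]_4) : F a b c d = - F a b d c by exact: Rm_skew.
have := B x y z w; have := B y z w x; have := B z w x y; have := B w x y z.
have := S2 y z w x; have := S2 z w y x; have := S2 w x z y; have := S2 x y w z.
have := S1 w y z x; have := S2 y w z x; have := S1 x z w y; have := S2 z x w y.
rewrite -/(F x y z w) -/(F z w x y); clearbody F; lra.
Qed.

(** Pair symmetry moves [xi] to the third argument, where the curvature is known. *)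
Lemma Rm_xi2 v w : Rm v xi w = e w *: v - g v w *: xi.
Proof.
apply/eqP; rewrite -subr_eq0; apply/eqP/bilin_nondeg => z.
rewrite bilinDl bilinNl Rm_pair Rm_skew Rm_xi.
rewrite !(bilinDl, bilinNl, bilinZl) [g xi z]bilinC// bilin_xi.
by rewrite [g w v]bilinC// [g z v]bilinC//; ring.
Qed.

Variable Sm : 'M[R]_4.
Hypothesis SmE : Sm = \matrix_(p, q) \sum_(k < 4) Rm (ebase R k) (ebase R p)
    (ebase R q) 0 k.
Local Notation S := (bilin Sm).

Lemma RmDm x y y' z : Rm x (y + y') z = Rm x y z + Rm x y' z.
Proof. by rewrite RmC RmDl opprD -!(RmC x). Qed.
Lemma RmZm a x y z : Rm x (a *: y) z = a *: Rm x y z.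
Proof. by rewrite RmC RmZl -scalerN -RmC. Qed.

Lemma ricciE y z : S y z = \sum_(k < 4) Rm (ebase R k) y z 0 k.
Proof.
have S0 (l : 'rV[R]_4 -> R) u : (forall v w, l (v + w) = l v + l w) ->
  (forall a v, l (a *: v) = a * l v) -> l u = \sum_(k < 4) u 0 k * l (ebase R k).
  by move=> lD lZ; rewrite -(contract_linear u lD lZ); apply: eq_bigr => k _;
      rewrite mulrC.
rewrite (S0 (fun y => S y z)); try by move=> *; rewrite (bilinDl, bilinZl).
rewrite (S0 (fun y => \sum_(k < 4) Rm (ebase R k) y z 0 k)); last first.
- by move=> a v; rewrite mulr_sumr; apply: eq_bigr => k _; rewrite RmZm mxE.
- by move=> v w; rewrite -big_split; apply: eq_bigr => k _; rewrite RmDm mxE.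
apply: eq_bigr => p _; congr (_ * _).
rewrite (S0 (fun z => S (ebase R p) z)); try by move=> *; rewrite (bilinDr, bilinZr).
rewrite (S0 (fun z => \sum_(k < 4) Rm (ebase R k) (ebase R p) z 0 k)); last first.
- by move=> a v; rewrite mulr_sumr; apply: eq_bigr => k _; rewrite RmZr mxE.
- by move=> v w; rewrite -big_split; apply: eq_bigr => k _; rewrite RmDr mxE.
apply: eq_bigr => q _; congr (_ * _).
rewrite /bilin trmx_delta -rowE -colE !mxE.
by rewrite SmE mxE.
Qed.

Lemma ricci_xi y : S y xi = 3 * e y.
Proof.
rewrite ricciE; transitivity (\sum_(k < 4) (e y * ebase R k 0 k - e (ebase R k)
    * y 0 k)).
  by apply: eq_bigr => k _; rewrite Rm_xi !mxE.
by rewrite sumrB -mulr_sumr sum_ebase contract_form1; ring.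
Qed.

Lemma ricci_xi_l z : S xi z = 3 * e z.
Proof.
rewrite ricciE; transitivity (\sum_(k < 4) (e z * ebase R k 0 k - g (ebase R k)
    z * xi 0 k)).
  by apply: eq_bigr => k _; rewrite Rm_xi2 !mxE.
by rewrite sumrB -mulr_sumr sum_ebase contract_bilin [g xi z]bilinC// bilin_xi; ring.
Qed.

Let Q := Sm *m invmx G.

Lemma ricci_opE x y : g (x *m Q) y = S x y.
Proof. by rewrite /bilin /Q mulmxA mulmxKV. Qed.

Lemma ricci_op_xi : xi *m Q = 3 *: xi.
Proof.
apply/eqP; rewrite -subr_eq0; apply/eqP/bilin_nondeg => z.
rewrite bilinDl bilinNl bilinZl ricci_opE ricci_xi_l [g xi z]bilinC// bilin_xi; ring.
Qed.

(* Taking [y = z = xi] determines the Ricci operator up to the scalar [s]. *)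
Lemma eta_constant_quasi_conformal a b s : a != 0 -> b != 0 ->
  (forall x y z, a *: Rm x y z
    + b *: (S y z *: x - S x z *: y + g y z *: (x *m Q) - g x z *: (y *m Q))
    - s *: wedge x y z = 0) ->
  exists c, forall x y z, Rm x y z = wedge x y z + c *: hwedge x y z.
Proof.
move=> a0 b0 H; pose p := - (a + 3 * b - s) / b.
have sE : s = a + 3 * b + p * b by rewrite /p; field.
have QE x j : (x *m Q) 0 j = p * x 0 j + (p - 3) * e x * xi 0 j.
  have /(congr1 (fun w : 'rV[R]_4 => w 0 j)) := H x xi xi.
  rewrite /wedge Rm_xi !ricci_xi !bilin_xi e_xi ricci_op_xi.
  move: (x *m Q) => q; rewrite !mxE sE => E.
  have : b * (q 0 j - (p * x 0 j + (p - 3) * e x * xi 0 j)) = 0 by rewrite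
      -[RHS]oppr0 -E; ring.
  by move=> /eqP; rewrite mulf_eq0 (negbTE b0) subr_eq0 => /eqP.
have SE x y : S x y = p * g x y + (p - 3) * e x * e y.
  have -> : S x y = g (p *: x + ((p - 3) * e x) *: xi) y.
    by rewrite -ricci_opE; congr g; apply/rowP => j; rewrite QE !mxE.
  by rewrite bilinDl !bilinZl [g xi y]bilinC// bilin_xi.
(* With Q = 3 I + (p - 3) P and S = 3 g + (p - 3) h the bracket multiplied by [b] is
   [6 wedge + (p - 3) (wedge + hwedge)]; the value of [s] reduces the total coefficient of [wedge]
   to [a]. *)
exists (- b * (p - 3) / a) => x y z; apply/rowP => j.
have /(congr1 (fun w : 'rV[R]_4 => w 0 j)) := H x y z.
rewrite /wedge /hwedge /hmet /hproj !SE.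
move: (QE x j) (QE y j); move: (x *m Q) (y *m Q) (Rm x y z) => qx qy r Ex Ey.
rewrite !mxE Ex Ey sE => E; apply: (mulfI a0).
rewrite -[LHS]addr0 -[X in _ + X]oppr0 -E; field.
exact: a0.
Qed.

(* Both [hwedge] and the deviation of [Rm] from [wedge] vanish as soon as one
   argument is [xi]; so it is enough to compare them on [xi]'s complement. *)
Lemma eta_constant_horizontal c :
  (forall x y z, e x = 0 -> e y = 0 -> e z = 0 -> Rm x y z = (1 + c) *: wedge x y z) ->
  forall x y z, Rm x y z = wedge x y z + c *: hwedge x y z.
Proof.
move=> H x y z.
have e1 := form1_hproj x; have e2 := form1_hproj y; have e3 := form1_hproj z.
have E1 : Rm x y z = Rm x y (hproj z) - e z *: Rm x y xi.
  by rewrite {1}(hprojK z) RmDr -scaleNr RmZr scaleNr.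
have E2 : Rm x y (hproj z) = Rm x (hproj y) (hproj z) - e y *: Rm x xi (hproj z).
  by rewrite {1}(hprojK y) RmDm -scaleNr RmZm scaleNr.
have E3 : Rm x (hproj y) (hproj z) = Rm (hproj x) (hproj y) (hproj z)
    + e x *: Rm (hproj y) xi (hproj z).
  by rewrite {1}(hprojK x) RmDl -scaleNr RmZl scaleNr [Rm xi _ _]RmC scalerN opprK.
rewrite E1 E2 E3 (H _ _ _ e1 e2 e3) Rm_xi !Rm_xi2 /wedge /hwedge /hmet e3.
rewrite /hproj !(bilinDl, bilinDr, bilinZl, bilinZr) !bilin_xi e_xi.
rewrite ![g xi _]bilinC// !bilin_xi.
by apply/rowP => j; rewrite !mxE; ring.
Qed.

(** The terms with the Ricci operator and with [r] agree on both sides, so on the complement of [xi]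
    the curvature is expressed through S and g alone. Skew symmetry of the curvature then becomes a
    linear identity for S, and its trace makes S a multiple of g there. *)
Lemma eta_constant_conformally_symmetric r :
  (forall x y z, e x = 0 -> e y = 0 -> e z = 0 ->
    Rm x y z - 2^-1 *: (g y z *: (x *m Q) - g x z *: (y *m Q) + S y z *: x - S x z *: y)
      + (r / 6) *: wedge x y z =
    g y z *: (- 2^-1 *: (x *m Q) + (r / 6 - 2^-1) *: x)
    - g x z *: (- 2^-1 *: (y *m Q) + (r / 6 - 2^-1) *: y)) ->
  exists c, forall x y z, Rm x y z = wedge x y z + c *: hwedge x y z.
Proof.
move=> H.
have RE x y z : e x = 0 -> e y = 0 -> e z = 0 ->
    Rm x y z = 2^-1 *: (S y z *: x - S x z *: y - wedge x y z).
  move=> ex ey ez; have := H x y z ex ey ez; rewrite /wedge.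
  move: (x *m Q) (y *m Q) (Rm x y z) => qx qy t /rowP E; apply/rowP => j.
  have := E j; rewrite !mxE; lra.
have SE x y z w : e x = 0 -> e y = 0 -> e z = 0 -> e w = 0 ->
    S y z * g x w - S x z * g y w + S y w * g x z - S x w * g y z = 0.
  move=> ex ey ez ew; have := Rm_skew x y z w; rewrite !RE// /wedge.
  rewrite !(bilinZl, bilinDl, bilinNl); lra.
pose q := (\sum_(k < 4) (hproj (ebase R k) *m Q) 0 k) / 3.
have Sq y z : e y = 0 -> e z = 0 -> S y z = q * g y z.
  move=> ey ez.
  (* [SE] as an identity of vectors, with [w] removed by nondegeneracy; projecting [x] makes it
     valid for every [x], so that the trace over [x] can be taken. *)
  have V x : S y z *: hproj x - S (hproj x) z *: y + g (hproj x) z *: (y *m Q)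
      - g y z *: (hproj x *m Q) = 0.
    have := form1_hproj x; move: (hproj x) => px ep.
    apply: bilin_nondeg => w; rewrite !(bilinZl, bilinDl, bilinNl) !ricci_opE.
    have N v : g v w = g v (hproj w) - e w * e v.
      by rewrite {1}(hprojK w) bilinDr bilinNr bilinZr bilin_xi.
    have N' v : S v w = S v (hproj w) - e w * (3 * e v).
      by rewrite {1}(hprojK w) bilinDr bilinNr bilinZr ricci_xi.
    rewrite (N px) (N y) (N' y) (N' px) ep ey.
    have := SE px y z (hproj w) ep ey ez (form1_hproj w); lra.
  have T : \sum_(k < 4) (S y z * hproj (ebase R k) 0 k - S (hproj (ebase R k)) z * y 0 k
      + g (hproj (ebase R k)) z * (y *m Q) 0 k - g y z * (hproj (ebase R k) *m
          Q) 0 k) = 0.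
    rewrite big1// => k _; move: (V (ebase R k)).
    move: (y *m Q) (hproj (ebase R k) *m Q) => yq pq.
    move: (hproj (ebase R k)) => p /rowP/(_ k).
    by rewrite !mxE => <-; ring.
  have eQ : e (y *m Q) = 0 by rewrite -bilin_xi ricci_opE ricci_xi ey mulr0.
  move: T; rewrite !(sumrB, big_split)/= -!mulr_sumr contract_hproj -/q.
  have pD v w : hproj (v + w) = hproj v + hproj w.
    by rewrite /hproj form1D scalerDl addrACA.
  have pZ a v : hproj (a *: v) = a *: hproj v.
    by rewrite /hproj form1Z -scalerA scalerDr.
  rewrite (@contract_linear (fun v => S (hproj v) z)); try by move=> *;
      rewrite (pD, pZ) (bilinDl, bilinZl).
  rewrite (@contract_linear (fun v => g (hproj v) z)); try by move=> *;
      rewrite (pD, pZ) (bilinDl, bilinZl).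
  rewrite !hproj_id// ricci_opE.
  have -> : \sum_(k < 4) (hproj (ebase R k) *m Q) 0 k = 3 * q by rewrite /q; field.
  move=> T; apply: (mulfI (_ : 3 != 0 :> R)); first by rewrite pnatr_eq0.
  lra.
(* With S = q g the curvature on the complement is [(q - 1) / 2], which has to equal [1 + c]. *)
exists ((q - 3) / 2); apply: eta_constant_horizontal => x y z ex ey ez.
rewrite RE// !Sq// /wedge; apply/rowP => j; rewrite !mxE; by field.
Qed.
End CurvatureAlgebra.

Lemma hmetE x y : hmet x y = g (hproj x) y.
Proof. by rewrite /hmet /hproj bilinDl bilinZl [g xi y]bilinC// bilin_xi. Qed.

Lemma hmetC x y : hmet x y = hmet y x.
Proof. by rewrite /hmet bilinC// mulrC. Qed.

Lemma hproj_xi : hproj xi = 0.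
Proof. by rewrite /hproj e_xi scaleN1r subrr. Qed.

(** * Consequences of the second Bianchi identity, in one tangent space *)

Section BianchiAlgebra.
Variables (c : R) (du : 'rV[R]_4 -> R).
Hypothesis c0 : c != 0.
Hypothesis duD : forall u v, du (u + v) = du u + du v.
Hypothesis duZ : forall a u, du (a *: u) = a * du u.
Local Notation Om x y := (g (x *m phi) y).

(* The covariant derivative in the direction [w] of [c *: hwedge x y z]. *)
Definition cov_hwedge w x y z := du w *: hwedge x y z +
  c *: ((Om w y * e z + e y * Om w z) *: hproj x
        - (Om w x * e z + e x * Om w z) *: hproj y
        + hmet y z *: (Om w x *: xi + e x *: (w *m phi))
        - hmet x z *: (Om w y *: xi + e y *: (w *m phi))).

Hypothesis cov_bianchi : forall w x y z,
  cov_hwedge w x y z + cov_hwedge x y w z + cov_hwedge y w x z = 0.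

(** Setting [w = xi] and tracing over [x] makes [phi] a multiple [t] of the projection [P]; then
    [phi^2 = P] gives [t^2 = 1], and [t] is one third of the trace. The value of [du] on [xi] comes
    out of the same trace. *)
Lemma bianchi_rigidity :
  [/\ (\tr phi / 3) ^+ 2 = 1,
      forall x, x *m phi = (\tr phi / 3) *: hproj x
    & forall x, du x = 2 * (\tr phi / 3) * c * e x].
Proof.
have Om_xi x : Om x xi = 0 by rewrite bilin_xi form1_phi.
have hxi z : hmet xi z = 0 by rewrite hmetE hproj_xi bilin0l.
have E1 x y z : du xi *: hwedge x y z + c *: (Om y z *: hproj x - Om x z *: hproj y
    + hmet y z *: (x *m phi) - hmet x z *: (y *m phi)) = 0.
  rewrite -[RHS](cov_bianchi xi x y z) /cov_hwedge /hwedge phi_xi !bilin0l !Om_xi.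
  rewrite !hxi hproj_xi e_xi; move: (x *m phi) (y *m phi) (hproj x)
      (hproj y) => p q px py.
  by apply/rowP => j; rewrite !mxE; ring.
have trphi : \sum_(k < 4) (ebase R k *m phi) 0 k = \tr phi.
  by apply: eq_bigr => k _; rewrite -rowE mxE.
have hmet_proj x z : hmet (hproj x) z = hmet x z.
  by rewrite hmetE hproj_id ?form1_hproj// -hmetE.
have proj_phi x : hproj x *m phi = x *m phi.
  by rewrite /hproj mulmxDl -scalemxAl phi_xi scaler0 addr0.
have hmet_phi x z : hmet (x *m phi) z = Om x z.
  by rewrite hmetE hproj_id ?form1_phi.
have E2 y z : (2 * du xi + c * \tr phi) * hmet y z + c * Om y z = 0.
  have : \sum_(k < 4) (du xi * (hmet y z * hproj (ebase R k) 0 k - hmet (ebase R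
      k) z * hproj y 0 k)
     + c * (Om y z * hproj (ebase R k) 0 k - Om (ebase R k) z * hproj y 0 k
      + hmet y z * (ebase R k *m phi) 0 k - hmet (ebase R k) z * (y *m phi) 0 k)) = 0.
    rewrite big1// => k _; move: (E1 (ebase R k) y z); rewrite /hwedge.
    move: (hproj (ebase R k)) (hproj y) (ebase R k *m phi) (y *m phi) =>
        p q r s /rowP/(_ k).
    by rewrite !mxE => <-; ring.
  rewrite big_split/= -!mulr_sumr !(sumrB, big_split)/= -!mulr_sumr
      contract_hproj trphi.
  rewrite !contract_hmet hmet_proj hmet_phi.
  rewrite (@contract_linear (fun v => Om v z)); last 2 first.
  - by move=> v w; rewrite mulmxDl bilinDl.
  - by move=> a v; rewrite -scalemxAl bilinZl.
  by rewrite proj_phi => <-; ring.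
pose t := - (2 * du xi + c * \tr phi) / c.
have phiE x : x *m phi = t *: hproj x.
  apply/eqP; rewrite -subr_eq0; apply/eqP/bilin_nondeg => z.
  rewrite bilinDl bilinNl bilinZl -hmetE.
  apply: (mulfI c0); rewrite mulr0 -[RHS](E2 x z) /t; by field.
have tE : \tr phi = 3 * t.
  rewrite -trphi -contract_hproj mulr_suml; apply: eq_bigr => k _.
  by rewrite phiE !mxE mulrC.
have -> : \tr phi / 3 = t by rewrite tE; field.
have t2 : t ^+ 2 = 1.
  have : \sum_(k < 4) hproj (ebase R k) 0 k = \sum_(k < 4) t ^+ 2 * hproj (ebase
      R k) 0 k.
    apply: eq_bigr => k _; rewrite {1}/hproj -phi2 phiE hproj_id ?form1_phi//.
    by rewrite phiE scalerA mxE expr2.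
  by rewrite -mulr_sumr contract_hproj; lra.
have duxi : du xi = - 2 * c * t.
  have : t * c = - (2 * du xi + c * (3 * t)) by rewrite -tE /t; field.
  by lra.
split=> //.
(* The deviation of [du] from its claimed value. It vanishes on [xi], and the cyclic sum of
   [th *: hwedge] is zero; a trace multiplies by the dimension of the complement less 2, and a last
   one by that dimension less 1, so dimension 3 forces [th = 0]. *)
pose th x := du x - 2 * t * c * e x.
have OmE x z : Om x z = t * hmet x z by rewrite phiE bilinZl hmetE.
have th_proj x : th (hproj x) = th x.
  by rewrite /th /hproj duD duZ form1D form1Z duxi e_xi; ring.
have T1 w x y z : th w *: hwedge x y z + th x *: hwedge y w z
    + th y *: hwedge w x z = 0.
  rewrite -[RHS](cov_bianchi w x y z) /cov_hwedge /hwedge !OmE !phiE /th.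
  rewrite (hmetC x w) (hmetC y w) (hmetC y x).
  move: (hproj x) (hproj y) (hproj w) => px py pw; apply/rowP => j; rewrite !mxE; ring.
have T2 w y z : th w * hmet y z = th y * hmet w z.
  have : \sum_(k < 4) (th w * (hmet y z * hproj (ebase R k) 0 k - hmet (ebase R
      k) z * hproj y 0 k)
     + (hmet w z * (th (ebase R k) * hproj y 0 k) - hmet y z * (th (ebase R k) *
         hproj w 0 k))
     + th y * (hmet (ebase R k) z * hproj w 0 k - hmet w z * hproj (ebase R k) 0
         k)) = 0.
    rewrite big1// => k _; move: (T1 w (ebase R k) y z); rewrite /hwedge.
    move: (hproj (ebase R k)) (hproj y) (hproj w) => p q r /rowP/(_ k).
    by rewrite !mxE => <-; ring.
  rewrite !(sumrB, big_split)/= -!mulr_sumr !(sumrB, big_split)/= -!mulr_sumr.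
  rewrite contract_hproj !contract_hmet !hmet_proj.
  have thD u v : th (u + v) = th u + th v by rewrite /th duD form1D; ring.
  have thZ a u : th (a *: u) = a * th u by rewrite /th duZ form1Z; ring.
  by rewrite !(contract_linear _ thD thZ) !th_proj; lra.
have T3 w y : th w *: hproj y = th y *: hproj w.
  apply/eqP; rewrite -subr_eq0; apply/eqP/bilin_nondeg => z.
  by rewrite bilinDl bilinNl !bilinZl -!hmetE T2 subrr.
move=> w; suff : th w = 0 by rewrite /th; lra.
have : \sum_(k < 4) th w * hproj (ebase R k) 0 k = \sum_(k < 4) th (ebase R k) *
    hproj w 0 k.
  by apply: eq_bigr => k _; have /rowP/(_ k) := T3 w (ebase R k); rewrite !mxE.
rewrite -mulr_sumr contract_hproj contract_linear ?th_proj.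
- by lra.
- by move=> u v; rewrite /th duD form1D; ring.
- by move=> a u; rewrite /th duZ form1Z; ring.
Qed.
End BianchiAlgebra.
End Tangent.

(** * The overdetermined system along the curve *)

Section RealDerivatives.
Variable R : realType.
Implicit Types (f h : R -> R) (t : R).

Lemma is_derive_mul t f h df dh : is_derive t 1 f df -> is_derive t 1 h dh ->
  is_derive t 1 (fun s => f s * h s) (df * h t + f t * dh).
Proof.
move=> Hf Hh.
have -> : df * h t + f t * dh = f t *: dh + h t *: df by rewrite addrC [df * _]mulrC.
exact: is_deriveM.
Qed.

Lemma is_derive_add t f h df dh : is_derive t 1 f df -> is_derive t 1 h dh ->
  is_derive t 1 (fun s => f s + h s) (df + dh).
Proof. by move=> Hf Hh; exact: is_deriveD. Qed.

Lemma is_derive_sub t f h df dh : is_derive t 1 f df -> is_derive t 1 h dh ->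
  is_derive t 1 (fun s => f s - h s) (df - dh).
Proof. by move=> Hf Hh; exact: is_deriveB. Qed.

Lemma is_derive_const t c : is_derive t 1 (fun=> c : R) 0.
Proof. exact: is_derive_cst. Qed.

Lemma is_derive_change t f df dg : is_derive t 1 f df -> df = dg -> is_derive t 1 f dg.
Proof. by move=> Hf <-. Qed.

Lemma is_derive_vanish (J : set R) t f df : open J -> J t -> is_derive t 1 f df ->
  (forall s, J s -> f s = 0) -> df = 0.
Proof.
move=> oJ Jt [_ <-] f0; rewrite -[RHS](derive_cst (0 : R) t 1).
apply: near_eq_derive; exact: eq_on_near oJ f0 Jt.
Qed.
End RealDerivatives.

(* [al], [be], [b], [d] stand for [eta T], [eta N], [eta B1], [eta B2]; [u] is
   the coefficient [c] of [eta_constant] along the curve, and [f] is the sign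
   in [phi = f (I + eta xi)]. *)
Section Overdetermined.
Variables (R : realType) (J : set R) (t1 : R).
Hypotheses (oJ : open J) (Jt1 : J t1).
Variables al be b d f k k2 k3 u f' : R -> R.
Hypothesis hf : forall t, J t -> is_derive t 1 f (f' t).
Hypothesis f2 : forall t, J t -> f t * f t = 1.
Hypothesis hk : forall t, J t -> is_derive t 1 k 0.
Hypothesis k0 : forall t, J t -> k t != 0.
Hypothesis hk2 : forall t, J t -> is_derive t 1 k2 (- u t * be t * b t).
Hypothesis hu : forall t, J t -> is_derive t 1 u (2 * f t * u t * al t).
Hypothesis hal : forall t, J t ->
  is_derive t 1 al (f t * (1 + al t * al t) + k t * be t).
Hypothesis hbe : forall t, J t ->
  is_derive t 1 be (f t * al t * be t + k t * al t + k2 t * b t).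
Hypothesis hb : forall t, J t ->
  is_derive t 1 b (f t * al t * b t + k2 t * be t + k3 t * d t).
Hypothesis hd : forall t, J t -> is_derive t 1 d (f t * al t * d t - k3 t * b t).
Hypothesis frame : forall t, J t ->
  be t * be t = 1 + al t * al t + (b t * b t + d t * d t).
Hypothesis normal1 : forall t, J t ->
  k t * k t + k2 t * k2 t + 1 = u t * (b t * b t + d t * d t).
Hypothesis normal3 : forall t, J t -> k2 t * k3 t = - u t * be t * d t.

Let w t := b t * b t + d t * d t.

Lemma frenet_system_inconsistent : False.
Proof.
have uw t : J t -> 0 < u t * w t.
  by move=> Jt; rewrite /w -normal1// ltr_wpDl// addr_ge0// -expr2 sqr_ge0.
have w_ge0 t : 0 <= w t by rewrite /w addr_ge0// -expr2 sqr_ge0.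
have u0 t : J t -> u t != 0.
  by move=> /uw; apply: contraTneq => ->; rewrite mul0r ltxx.
have w_gt0 t : J t -> 0 < w t.
  by move=> /uw Huw; rewrite lt0r w_ge0 andbT; apply: contraTneq Huw => ->;
      rewrite mulr0 ltxx.
have df t : J t -> is_derive t 1 f 0.
  move=> Jt; apply: is_derive_change (hf Jt) _.
  have E := is_derive_vanish oJ Jt (is_derive_sub (is_derive_mul (hf Jt)
      (hf Jt)) (is_derive_const t 1)) _.
  have {}E : f' t * f t + f t * f' t - 0 = 0 by apply: E => s Js; rewrite f2// subrr.
  have f0 : f t != 0 by apply/eqP => f0; have := f2 Jt; rewrite f0; lra.
  by apply: (mulfI f0); lra.
(* This is the derivative of [normal1] divided by [4 u], the terms with [k3] cancelling in the
   derivative of [w]. The same expression is half of that derivative, so [w] is constant. *)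
have H1 t : J t -> f t * al t * w t + k2 t * b t * be t = 0.
  move=> Jt.
  have dw := is_derive_add (is_derive_mul (hb Jt) (hb Jt))
      (is_derive_mul (hd Jt) (hd Jt)).
  have E := is_derive_vanish oJ Jt (is_derive_sub (is_derive_add (is_derive_add
      (is_derive_mul (hk Jt) (hk Jt)) (is_derive_mul (hk2 Jt) (hk2 Jt)))
      (is_derive_const t 1)) (is_derive_mul (hu Jt) dw)) _.
  have {}E := E (fun s Js => etrans (congr1 (fun x => x - _) (normal1 Js)) (subrr _)).
  apply: (mulfI (u0 t Jt)); rewrite /w; lra.
have dw t : J t -> is_derive t 1 w 0.
  move=> Jt; have dw := is_derive_add (is_derive_mul (hb Jt) (hb Jt))
      (is_derive_mul (hd Jt) (hd Jt)).
  apply: is_derive_change dw _; have := H1 t Jt; rewrite /w; lra.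
pose al' t := f t * (1 + al t * al t) + k t * be t.
pose be' t := f t * al t * be t + k t * al t + k2 t * b t.
have hal' t : J t -> is_derive t 1 al (al' t) by exact: hal.
have hbe' t : J t -> is_derive t 1 be (be' t) by exact: hbe.
have wE t : J t -> be t * be t = 1 + al t * al t + w t by exact: frame.
have bb t : J t -> be t * be' t = al t * al' t.
  move=> Jt.
  have E := is_derive_vanish oJ Jt (is_derive_sub (is_derive_mul (hbe' t Jt)
      (hbe' t Jt)) (is_derive_add (is_derive_add (is_derive_const t 1)
      (is_derive_mul (hal' t Jt) (hal' t Jt))) (dw t Jt))) _.
  have {}E := E (fun s Js => etrans (congr1 (fun x => x - _) (wE _ Js)) (subrr _)).
  by move: E; lra.
(* The derivative of [H1]; [normal3] eliminates [k3], and [normal1] then absorbs the square of [k2]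
   together with [u]. *)
have D t : J t -> f t * w t * al' t - (k t * k t + 1) * (be t * be t)
     + f t * al t * (k2 t * b t * be t) + k2 t * b t * be' t = 0.
  move=> Jt.
  have E := is_derive_vanish oJ Jt (is_derive_add (is_derive_mul (is_derive_mul
      (df t Jt) (hal' t Jt)) (dw t Jt)) (is_derive_mul (is_derive_mul (hk2 Jt)
      (hb Jt)) (hbe' t Jt))) H1.
  have e1 : (k2 t * k3 t + u t * be t * d t) * (d t * be t) = 0.
    by rewrite normal3//; ring.
  have e2 : (k t * k t + k2 t * k2 t + 1 - u t * w t) * (be t * be t) = 0.
    by rewrite normal1// subrr mul0r.
  by move: E e1 e2; rewrite /w; lra.
have Y t : J t -> k2 t * b t * be t = - (f t * al t * w t) by move=> Jt;
    have := H1 t Jt; lra.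
(* After multiplying [D] by the square of [be], the function [k2] occurs only in the product
   [k2 * b * be], which [H1] replaces by [- f * al * w]. *)
have P1 t : J t -> f t * w t * al' t * (1 + w t) =
    (k t * k t + 1) * (be t * be t) ^+ 2 + al t * al t * w t * (be t * be t).
  move=> Jt.
  have E : f t * w t * al' t * (be t * be t) - (k t * k t + 1) * (be t * be t) ^+ 2
     + f t * al t * (k2 t * b t * be t) * (be t * be t)
         + (k2 t * b t * be t) * (be t * be' t) = 0.
    by rewrite -[RHS](mulr0 (be t * be t)) -(D t Jt); ring.
  have E2 : 1 + w t = be t * be t - al t * al t by rewrite wE//; ring.
  rewrite E2; move: E; rewrite bb// Y//.
  have ff := f2 Jt; move: (f t) (w t) (al' t) (al t) (be t) (k t) ff =>
      F W A' A B K ff E.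
  have -> : A * A * W * (B * B) = (F * F) * (A * A * W * (B * B)) by rewrite ff mul1r.
  by rewrite -[LHS]subr0 -E; ring.
have be0 t : J t -> be t != 0.
  move=> Jt; apply/eqP => b0; have := wE t Jt; rewrite b0 mul0r.
  by have := w_gt0 t Jt; have := sqr_ge0 (al t); rewrite expr2; lra.
have al'0 t : J t -> al' t != 0.
  move=> Jt; apply/eqP => a0; have := P1 t Jt; rewrite a0 mulr0 mul0r.
  have b2 : 0 < be t * be t by rewrite -expr2 exprn_even_gt0//= be0.
  have : 0 < (k t * k t + 1) * (be t * be t) ^+ 2.
    by rewrite mulr_gt0 ?exprn_gt0// ltr_wpDl// -expr2 sqr_ge0.
  have : 0 <= al t * al t * w t * (be t * be t).
    by apply: mulr_ge0 (ltW b2); apply: mulr_ge0 (w_ge0 t); rewrite -expr2 sqr_ge0.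
  by lra.
(* By [bb] and [al' != 0] a factor [be'] may be traded for [al], so each differentiation of an
   equation in [be] yields a relation free of derivatives. *)
have al_be' t x : J t -> x * be' t = 0 -> x * al t = 0.
  move=> Jt H; apply: (mulIf (al'0 t Jt)).
  by rewrite mul0r -mulrA -bb// mulrCA H mulr0.
pose A t := k t * k t + 1 + w t.
pose B t := w t * (1 + w t).
pose C t := B t * (f t * k t).
have dA t : J t -> is_derive t 1 A 0.
  move=> Jt; apply: is_derive_change (is_derive_add (is_derive_add
      (is_derive_mul (hk Jt) (hk Jt)) (is_derive_const t 1)) (dw t Jt)) _.
  by ring.
have dB t : J t -> is_derive t 1 B 0.
  move=> Jt; apply: is_derive_change (is_derive_mul (dw t Jt)
      (is_derive_add (is_derive_const t 1) (dw t Jt))) _.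
  by ring.
have dC t : J t -> is_derive t 1 C 0.
  move=> Jt; apply: is_derive_change (is_derive_mul (dB t Jt)
      (is_derive_mul (df t Jt) (hk Jt))) _.
  by ring.
pose b2 t := be t * be t.
have db2 t (Jt : J t) := is_derive_mul (hbe' t Jt) (hbe' t Jt).
(* A quartic equation for [be], with coefficients that are constant along the
   curve; differentiating it three times forces [al = 0]. *)
have p0 t : J t -> A t * (b2 t * b2 t) - 2 * B t * b2 t - C t * be t + w t * B t = 0.
  move=> Jt; have := P1 t Jt; have ff := f2 Jt.
  have -> : al t * al t = b2 t - 1 - w t by rewrite /b2 wE//; ring.
  have -> : f t * w t * al' t = w t * (f t * f t * (1 + al t * al t)
      + f t * k t * be t).
    by rewrite /al'; ring.
  have -> : al t * al t = b2 t - 1 - w t by rewrite /b2 wE//; ring.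
  rewrite ff /A /C /B -/(b2 t) => E.
  set rhs := (X in _ = X) in E; set lhs := (X in X = _) in E.
  have -> : 0 = rhs - lhs by rewrite E subrr.
  by rewrite /rhs /lhs; ring.
have p1 t : J t -> (4 * A t * (be t * b2 t) - 4 * B t * be t - C t) * al t = 0.
  move=> Jt; apply: al_be' => //.
  rewrite -[RHS](is_derive_vanish oJ Jt (is_derive_add (is_derive_sub
      (is_derive_sub (is_derive_mul (dA t Jt) (is_derive_mul (db2 t Jt)
      (db2 t Jt))) (is_derive_mul (is_derive_mul (is_derive_const t 2)
      (dB t Jt)) (db2 t Jt))) (is_derive_mul (dC t Jt) (hbe' t Jt)))
      (is_derive_mul (dw t Jt) (dB t Jt))) p0).
  by rewrite /b2; ring.
have dq t (Jt : J t) := is_derive_sub (is_derive_sub (is_derive_mul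
    (is_derive_mul (is_derive_const t 4) (dA t Jt)) (is_derive_mul (hbe' t Jt)
    (db2 t Jt))) (is_derive_mul (is_derive_mul (is_derive_const t 4)
    (dB t Jt)) (hbe' t Jt))) (dC t Jt).
(* Differentiating [p1] also produces a term with [al']; after multiplication by [al] it vanishes by
   [p1]. This, and the exchange of [be'] for [al], raise the power of [al] by 2 here and again in
   [p3]. *)
have p2 t : J t -> (12 * A t * b2 t - 4 * B t) * (al t * al t * al t) = 0.
  move=> Jt; suff : (12 * A t * b2 t - 4 * B t) * al t * al t * be' t = 0.
    by move/(al_be' _ _ Jt) => <-; rewrite !mulrA.
  have E := is_derive_vanish oJ Jt (is_derive_mul (dq t Jt) (hal' t Jt)) p1.
  have := congr1 (fun x => x * al t) E; have := congr1 (fun x => x * al' t) (p1 t Jt).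
  by rewrite /b2; lra.
have p3 t : J t -> (24 * A t * be t) * (al t * al t * al t * al t * al t) = 0.
  move=> Jt; suff : 24 * A t * be t * al t * al t * al t * al t * be' t = 0.
    by move/(al_be' _ _ Jt) => <-; rewrite !mulrA.
  have E := is_derive_vanish oJ Jt (is_derive_mul (is_derive_sub (is_derive_mul
      (is_derive_mul (is_derive_const t 12) (dA t Jt)) (db2 t Jt))
      (is_derive_mul (is_derive_const t 4) (dB t Jt)))
      (is_derive_mul (is_derive_mul (hal' t Jt) (hal' t Jt)) (hal' t Jt))) p2.
  have := congr1 (fun x => x * al t) E; have := congr1 (fun x =>
      x * (3 * al' t)) (p2 t Jt).
  by rewrite /b2; lra.
have al0 t : J t -> al t = 0.
  move=> Jt; have := p3 t Jt.
  have A0 : A t != 0.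
    by rewrite gt_eqF// /A ltr_wpDl ?w_gt0// addr_ge0// -expr2 sqr_ge0.
  move=> /eqP; rewrite !mulf_eq0 (negbTE A0) (negbTE (be0 t Jt)) pnatr_eq0 /=.
  by rewrite !orbb => /eqP.
have := is_derive_vanish oJ Jt1 (hal' t1 Jt1) al0.
exact/eqP/al'0.
Qed.
End Overdetermined.

(** * The curvature of LP-Sasakian charts *)

Lemma cov_cst (R : realType) n (Gam : 'rV[R]_n -> 'I_n -> 'I_n -> 'rV[R]_n) x v w :
  cov Gam x v (fun=> w) = christoffel (Gam x) v w.
Proof. by rewrite /cov derive_cst add0r. Qed.

Section LPSasakian.
#[local] Opaque curvature_at cov bilin.
Variables (R : realType) (U : set 'rV[R]_4).
Variables (Gam : 'rV[R]_4 -> 'I_4 -> 'I_4 -> 'rV[R]_4).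
Variables (G Phi : 'rV[R]_4 -> 'M[R]_4) (Xi : 'rV[R]_4 -> 'rV[R]_4).
Variable Eta : 'rV[R]_4 -> 'cV[R]_4.
Implicit Types (u v w x y z : 'rV[R]_4) (X Y Z W : field R 4).
Hypothesis oU : open U.
Hypothesis sGam : forall k l, smooth_on U (fun x => Gam x k l).
Hypotheses (sG : smooth_on U G) (sPhi : smooth_on U Phi).
Hypotheses (sXi : smooth_on U Xi) (sEta : smooth_on U Eta).
Hypothesis GC : forall x, U x -> (G x)^T = G x.
Hypothesis Gu : forall x, U x -> G x \in unitmx.
Hypothesis torsion_free : forall X Y x, smooth_on U X -> smooth_on U Y -> U x ->
  nabla Gam X Y x - nabla Gam Y X x = lie_bracket X Y x.
Hypothesis metric : forall X Y Z x,
  smooth_on U X -> smooth_on U Y -> smooth_on U Z -> U x ->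
  'D_(Z x) (fun z => bilin (G z) (X z) (Y z)) x =
  bilin (G x) (nabla Gam Z X x) (Y x) + bilin (G x) (X x) (nabla Gam Z Y x).
Hypothesis e_xi : forall x, U x -> form1 (Eta x) (Xi x) = -1.
Hypothesis phi2 : forall x u, U x ->
  u *m Phi x *m Phi x = u + form1 (Eta x) u *: Xi x.
Hypothesis g_phi : forall x u v, U x ->
  bilin (G x) (u *m Phi x) (v *m Phi x) =
  bilin (G x) u v + form1 (Eta x) u * form1 (Eta x) v.
Hypothesis nabla_phi : forall X Y x, smooth_on U X -> smooth_on U Y -> U x ->
  nabla_endo Gam Phi X Y x =
  bilin (G x) (X x *m Phi x) (Y x *m Phi x) *: Xi x
  + form1 (Eta x) (Y x) *: (X x *m Phi x *m Phi x).

Local Notation rm := (curvature_at Gam).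
Local Notation cv := (cov Gam).
Local Notation gg x := (bilin (G x)).
Local Notation ee x := (form1 (Eta x)).
Local Notation cst v := (fun _ : 'rV[R]_4 => v).

Let sc w : smooth_on U (cst w).
Proof. exact: smooth_cst. Qed.

Let sd X x : smooth_on U X -> U x -> differentiable X x.
Proof. exact: smooth_differentiable. Qed.

Lemma cov_cstC x u v : U x -> cv x u (cst v) = cv x v (cst u).
Proof.
move=> Ux; have := torsion_free (sc u) (sc v) Ux.
by rewrite /lie_bracket !derive_cst subrr => /eqP; rewrite subr_eq0 => /eqP.
Qed.

Lemma christoffelC x u v : U x -> christoffel (Gam x) u v = christoffel (Gam x) v u.
Proof.
move=> Ux; have := cov_cstC u v Ux.
by rewrite !cov_cst.
Qed.

Lemma derive_bilin x v Y Z : U x -> smooth_on U Y -> smooth_on U Z ->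
  'D_v (fun z => gg z (Y z) (Z z)) x = gg x (cv x v Y) (Z x) + gg x (Y x) (cv x v Z).
Proof. by move=> Ux sY sZ; exact: metric sY sZ (sc v) Ux. Qed.

(** Constancy of g(xi, xi) gives [eta(nabla_v xi) = 0], and differentiating [phi xi = 0] gives
    [phi (nabla_v xi) = phi^2 v]. One more application of [phi] isolates [nabla_v xi]. *)
Lemma cov_xi x v : U x -> cv x v Xi = v *m Phi x.
Proof.
move=> Ux.
have ux := phi2 _ Ux; have gx := fun u v => g_phi u v Ux.
have eC : ee x (cv x v Xi) = 0.
  rewrite -(bilin_xi (e_xi Ux) ux gx).
  have : 'D_v (fun z => gg z (Xi z) (Xi z)) x = 0.
    rewrite -[RHS](derive_cst (-1 : R) x v).
    apply: near_eq_derive; apply: eq_on_near Ux => // y Uy.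
    by rewrite (bilin_xi (e_xi Uy) (fun u => phi2 u Uy) (fun u v => g_phi u v Uy)) e_xi.
  by rewrite (derive_bilin v Ux sXi sXi) (bilinC _ (Xi x) (GC Ux)); lra.
have E : cv x v Xi *m Phi x = v *m Phi x *m Phi x.
  have := nabla_phi (sc v) sXi Ux; rewrite /nabla_endo.
  have -> : nabla Gam (cst v) (fun z => Xi z *m Phi z) x = 0.
    rewrite -[RHS](cov_cst0 Gam x v).
    apply: (@cov_eq _ _ U _ oU _ v _ _ Ux) => y Uy.
    by rewrite (phi_xi (e_xi Uy) (fun u => phi2 u Uy)).
  rewrite (phi_xi (e_xi Ux) ux) bilin0r scale0r !add0r (e_xi Ux) scaleN1r => /oppr_inj.
  by [].
have := congr1 (fun w => w *m Phi x) E; rewrite /= !ux eC scale0r addr0 => ->.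
by rewrite (form1_phi (e_xi Ux) ux) scale0r addr0.
Qed.

Lemma derive_form1 x v Y : U x -> smooth_on U Y ->
  'D_v (fun z => ee z (Y z)) x = gg x (v *m Phi x) (Y x) + ee x (cv x v Y).
Proof.
move=> Ux sY; have bx y u (Uy : U y) :=
  bilin_xi (e_xi Uy) (fun u => phi2 u Uy) (fun u v => g_phi u v Uy) u.
have -> : 'D_v (fun z => ee z (Y z)) x = 'D_v (fun z => gg z (Y z) (Xi z)) x.
  apply: near_eq_derive; apply: eq_on_near Ux => // y Uy; exact: esym (bx y _ Uy).
rewrite (derive_bilin v Ux sY sXi) (cov_xi v Ux) (bx x _ Ux) addrC.
by rewrite (bilinC _ _ (GC Ux)).
Qed.

(** Since [nabla_b xi = phi b], a second derivative of [xi] is given by the formula for [nabla phi];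
    its part symmetric in the two directions drops out. *)
Lemma curvature_xi x u v : U x -> rm x u v (Xi x) = ee x v *: u - ee x u *: v.
Proof.
move=> Ux; rewrite -(riemE oU sGam u v Ux sXi) /riem.
have E a b : cv x a (nabla_cst Gam b Xi) = gg x (a *m Phi x) (b *m Phi x) *: Xi x
    + ee x b *: (a + ee x a *: Xi x) + cv x a (cst b) *m Phi x.
  rewrite -(phi2 a Ux) -(nabla_phi (sc a) (sc b) Ux) /nabla_endo.
  rewrite subrK; apply: (@cov_eq _ _ U _ oU _ a _ _ Ux) => y Uy.
  exact: cov_xi.
rewrite (E u v) (E v u) (cov_cstC u v Ux) (bilinC (u *m Phi x) _ (GC Ux)).
move: (gg x _ _) (cv x _ _ *m _) => a b; apply/rowP => j; rewrite !mxE; ring.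
Qed.

Let hxi x (Ux : U x) := e_xi Ux.
Let hphi2 x (Ux : U x) := fun u => phi2 u Ux.
Let hgphi x (Ux : U x) := fun u v => g_phi u v Ux.

Definition eta_constant x c := forall u v w,
  rm x u v w = wedge (G x) u v w + c *: hwedge (G x) (Xi x) (Eta x) u v w.

Section Pointwise.
Variables (x : 'rV[R]_4) (Ux : U x).
Let rDl u u' v w := curvature_atDl oU sGam u u' v w Ux.
Let rZl a u v w := curvature_atZl oU sGam a u v w Ux.
Let rDr u v w w' := curvature_atDr oU sGam u v w w' Ux.
Let rZr a u v w := curvature_atZr oU sGam a u v w Ux.
Let rC u v w := curvature_at_skew oU sGam u v w Ux.
Let rB u v w := bianchi1 oU sGam u v w Ux (fun y a b Uy => christoffelC a b Uy).
Let rS u v w z := curvature_at_metric_skew oU sGam sG GC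
  (fun Y Z x v Ux sY sZ => derive_bilin v Ux sY sZ) u v w z Ux.
Let rX u v := curvature_xi u v Ux.

Lemma eta_constant_of_quasi a b s : a != 0 -> b != 0 ->
  (forall u v w, a *: rm x u v w
    + b *: (ricci Gam x v w *: u - ricci Gam x u w *: v
      + gg x v w *: (u *m ricci_op Gam G x) - gg x u w *: (v *m ricci_op Gam G x))
    - s *: wedge (G x) u v w = 0) -> exists c, eta_constant x c.
Proof.
move=> a0 b0 H.
exact: (@eta_constant_quasi_conformal _ _ _ _ _ (GC Ux) (Gu Ux) (hxi Ux)
    (hphi2 Ux) (hgphi Ux)
  _ rDl rZl rDr rZr rC rB rS rX (ricci_mx Gam x) erefl _ _ s a0 b0 H).
Qed.

Lemma ricci_at_xi u : ricci Gam x u (Xi x) = 3 * ee x u.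
Proof.
exact: (@ricci_xi _ _ _ _ rDl rZl rDr rZr rC rX (ricci_mx Gam x) erefl u).
Qed.

End Pointwise.

(** The endomorphism with [C(X, Y)xi = eta(Y) L(X) - eta(X) L(Y)]. In the factor of [u], the number
    [- 1/2] is [1 - 3/2], from [R(X, Y)xi] and from [S(X, xi) = 3 eta(X)]. *)
Let L x u := - 2^-1 *: (u *m ricci_op Gam G x)
  + (scalar_curv Gam G x / 6 - 2^-1) *: u.

Let two_inv : (4%:R - 2)^-1 = 2^-1 :> R.
Proof. by congr (_^-1); lra. Qed.

Let six : (4%:R - 1) * (4%:R - 2) = 6 :> R.
Proof. by lra. Qed.

Lemma conformal_curvE X Y Z x : U x -> smooth_on U X -> smooth_on U Y ->
    smooth_on U Z ->
  conformal_curv Gam G X Y Z x = rm x (X x) (Y x) (Z x)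
  - 2^-1 *: (gg x (Y x) (Z x) *: (X x *m ricci_op Gam G x)
       - gg x (X x) (Z x) *: (Y x *m ricci_op Gam G x)
       + ricci Gam x (Y x) (Z x) *: X x - ricci Gam x (X x) (Z x) *: Y x)
  + (scalar_curv Gam G x / 6) *: wedge (G x) (X x) (Y x) (Z x).
Proof.
move=> Ux sX sY sZ; rewrite /conformal_curv two_inv six.
by rewrite (curvatureE oU sGam Ux sX sY sZ).
Qed.

Lemma conformal_curv_xi X Y x : U x -> smooth_on U X -> smooth_on U Y ->
  conformal_curv Gam G X Y Xi x = ee x (Y x) *: L x (X x) - ee x (X x) *: L x (Y x).
Proof.
move=> Ux sX sY; rewrite (conformal_curvE Ux sX sY sXi) /L /wedge.
rewrite (curvature_xi _ _ Ux) !(ricci_at_xi Ux).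
rewrite !(bilin_xi (hxi Ux) (hphi2 Ux) (hgphi Ux)).
move: (_ *m ricci_op _ _ _) (_ *m ricci_op _ _ _) => p q.
by apply/rowP => j; rewrite !mxE; field.
Qed.

(* For horizontal [X] and [Y] the field [C(X, Y)xi] vanishes identically, so
   one covariant derivative of it already expresses [C(X, Y)(phi W)]. *)
Lemma eta_constant_of_symmetric x : U x ->
  (forall W X Y Z y, smooth_on U W -> smooth_on U X -> smooth_on U Y ->
    smooth_on U Z -> U y -> nabla_curvlike Gam (conformal_curv Gam G) W X Y Z y = 0) ->
  exists c, eta_constant x c.
Proof.
move=> Ux H.
apply: (@eta_constant_conformally_symmetric _ _ _ _ _ (GC Ux) (Gu Ux) (hxi Ux)
    (hphi2 Ux) (hgphi Ux)
  (rm x) _ _ _ _ _ _ _ _ (ricci_mx Gam x) erefl (scalar_curv Gam G x)).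
- by move=> u u' v w; exact: (curvature_atDl oU sGam u u' v w Ux).
- by move=> a u v w; exact: (curvature_atZl oU sGam a u v w Ux).
- by move=> u v w w'; exact: (curvature_atDr oU sGam u v w w' Ux).
- by move=> a u v w; exact: (curvature_atZr oU sGam a u v w Ux).
- by move=> u v w; exact: (curvature_at_skew oU sGam u v w Ux).
- by move=> u v w; exact: (bianchi1 oU sGam u v w Ux (fun y a b Uy =>
    christoffelC a b Uy)).
- move=> u v w z; exact: (curvature_at_metric_skew oU sGam sG GC
    (fun Y Z x v Ux sY sZ => derive_bilin v Ux sY sZ) u v w z Ux).
- by move=> u v; exact: curvature_xi.
move=> u v w eu ev ew.
(* A smooth extension of the horizontal vector [a] that stays horizontal: the image of [phi] is
   annihilated by [eta], and at [x] the value is [phi^2 a = a]. *)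
pose F a : field R 4 := fun y => a *m Phi x *m Phi y.
have sF a : smooth_on U (F a) by apply: smooth_mulmx.
have Fx a : ee x a = 0 -> F a x = a by move=> ea; rewrite /F phi2// ea scale0r addr0.
have eF a y : U y -> ee y (F a y) = 0.
  by move=> Uy; exact: (form1_phi (hxi Uy) (hphi2 Uy)).
(* Chosen so that [nabla_w' xi = phi^2 w = w]: the term of the derivative in which [xi] is
   differentiated becomes C(u, v)w. *)
pose w' := w *m Phi x.
have sn Y : smooth_on U Y -> smooth_on U (nabla_cst Gam w' Y) by exact:
    smooth_nabla_cst.
have := H (cst w') (F u) (F v) Xi x (sc w') (sF u) (sF v) sXi Ux.
rewrite /nabla_curvlike.
have -> : nabla Gam (cst w') (conformal_curv Gam G (F u) (F v) Xi) x = 0.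
  rewrite -[RHS](cov_cst0 Gam x w').
  apply: (@cov_eq _ _ U _ oU _ w' _ _ Ux) => y Uy.
  by rewrite (conformal_curv_xi Uy (sF u) (sF v)) !eF// !scale0r subrr.
have eN a : ee x a = 0 -> ee x (nabla_cst Gam w' (F a) x) = - gg x w a.
  move=> ea; have := derive_form1 w' Ux (sF a).
  have -> : 'D_w' (fun z => ee z (F a z)) x = 0.
    rewrite -[RHS](derive_cst (0 : R) x w').
    by apply: near_eq_derive; apply: eq_on_near Ux => // y Uy; exact: eF.
  by rewrite -/(F w x) !Fx// nabla_cstE; lra.
have E1 := conformal_curv_xi Ux (sn _ (sF u)) (sF v).
have E2 := conformal_curv_xi Ux (sF u) (sn _ (sF v)).
have E3 := conformal_curvE Ux (sF u) (sF v) (sn _ sXi).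
have E4 : nabla_cst Gam w' Xi x = w by rewrite nabla_cstE (cov_xi w' Ux) -/(F w x) Fx.
rewrite E4 !Fx// in E3; rewrite !Fx// !eN// ev scale0r add0r in E1.
rewrite !Fx// !eN// eu scale0r subr0 in E2.
rewrite -/(nabla_cst Gam w' (F u)) -/(nabla_cst Gam w' (F v)) -/(nabla_cst Gam
    w' Xi) E1 E2 E3.
move=> E; apply/eqP; rewrite -subr_eq0 -oppr_eq0; apply/eqP; rewrite -[RHS]E.
rewrite (bilinC w u (GC Ux)) (bilinC w v (GC Ux)) /L /ricci.
move: (u *m ricci_op _ _ _) (v *m ricci_op _ _ _) (rm x u v w) => p q r.
by apply/rowP => j; rewrite !mxE; ring.
Qed.

Lemma smooth_form1 Y : smooth_on U Y -> smooth_on U (fun y => ee y (Y y)).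
Proof.
move=> sY; apply: (smooth_mxP oU (fun y => Y y *m Eta y)).1.
exact: smooth_mulmx.
Qed.

Lemma derive_mul x v (f h : 'rV[R]_4 -> R) : differentiable f x -> differentiable h x ->
  'D_v (fun y => f y * h y) x = 'D_v f x * h x + f x * 'D_v h x.
Proof.
move=> df dh.
rewrite [LHS](deriveM (diff_derivable (v := v) df) (diff_derivable (v := v) dh)).
by rewrite addrC [X in X + _]mulrC.
Qed.

Lemma derive_add x v (f h : 'rV[R]_4 -> R) : differentiable f x -> differentiable h x ->
  'D_v (fun y => f y + h y) x = 'D_v f x + 'D_v h x.
Proof. by move=> df dh; apply: deriveD; exact: diff_derivable. Qed.

(** The metric is parallel, so [wedge] contributes only Leibniz terms of its arguments; the
    derivatives of [c], [eta] and [xi] are collected in [cov_hwedge]. *)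
Lemma cov_eta_constant x (c : 'rV[R]_4 -> R) w a b z : U x -> differentiable c x ->
  cv x w (fun y => wedge (G y) a b z + c y *: hwedge (G y) (Xi y) (Eta y) a b z) =
  cov_hwedge (G x) (Phi x) (Xi x) (Eta x) (c x) (fun v => 'D_v c x) w a b z +
  (wedge (G x) (cv x w (cst a)) b z + c x *: hwedge (G x) (Xi x) (Eta x)
      (cv x w (cst a)) b z) +
  (wedge (G x) a (cv x w (cst b)) z + c x *: hwedge (G x) (Xi x)
      (Eta x) a (cv x w (cst b)) z) +
  (wedge (G x) a b (cv x w (cst z)) + c x *: hwedge (G x) (Xi x)
      (Eta x) a b (cv x w (cst z))).
Proof.
move=> Ux dc.
have dg u v : differentiable (fun y => gg y u v) x.
  exact: smooth_differentiable (smooth_bilin oU sG (sc u) (sc v)) Ux.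
have de u : differentiable (fun y => ee y u) x.
  exact: smooth_differentiable (smooth_form1 (sc u)) Ux.
have Dg u v : 'D_w (fun y => gg y u v) x = gg x (cv x w (cst u)) v
    + gg x u (cv x w (cst v)).
  by have := derive_bilin w Ux (sc u) (sc v).
have De u : 'D_w (fun y => ee y u) x = gg x (w *m Phi x) u + ee x (cv x w (cst u)).
  by have := derive_form1 w Ux (sc u).
have dcst (u : 'rV[R]_4) : differentiable (cst u) x by exact: differentiable_cst.
have dh u v : differentiable (fun y => hmet (G y) (Eta y) u v) x.
  by apply: differentiableD => //; exact: differentiableM.
have Dh u v : 'D_w (fun y => hmet (G y) (Eta y) u v) x =
    gg x (cv x w (cst u)) v + gg x u (cv x w (cst v)) +
    ((gg x (w *m Phi x) u + ee x (cv x w (cst u))) * ee x v +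
     ee x u * (gg x (w *m Phi x) v + ee x (cv x w (cst v)))).
  by rewrite -Dg -!De -derive_mul// -derive_add//; exact: differentiableM.
have dP u : differentiable (fun y => hproj (Xi y) (Eta y) u) x.
  by apply: differentiableD => //; apply: differentiable_scale => //; exact: sd sXi Ux.
have CP u : cv x w (fun y => hproj (Xi y) (Eta y) u) = cv x w (cst u) +
    ((gg x (w *m Phi x) u + ee x (cv x w (cst u))) *: Xi x + ee x u *: (w *m Phi x)).
  rewrite -De -(cov_xi w Ux) -(covZ _ w (de u) (sd sXi Ux)) -covD//.
  by apply: differentiable_scale => //; exact: sd sXi Ux.
have dZ (f : 'rV[R]_4 -> R) Y := @differentiable_scale _ _ f Y x.
have dw : differentiable (fun y => wedge (G y) a b z) x.
  by apply: differentiableB; exact: dZ.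
have dhw : differentiable (fun y => hwedge (G y) (Xi y) (Eta y) a b z) x.
  by apply: differentiableB; exact: dZ.
rewrite (covD _ w dw (dZ _ _ dc dhw)) (covZ _ w dc dhw).
rewrite (covB _ w (dZ _ _ (dg b z) (dcst a)) (dZ _ _ (dg a z) (dcst b))).
rewrite (covB _ w (dZ _ _ (dh b z) (dP a)) (dZ _ _ (dh a z) (dP b))).
rewrite (covZ _ w (dg b z) (dcst a)) (covZ _ w (dg a z) (dcst b)).
rewrite (covZ _ w (dh b z) (dP a)) (covZ _ w (dh a z) (dP b)).
rewrite !CP !Dh !Dg /cov_hwedge /wedge /hwedge /hmet /hproj.
move: (cv x w (cst a)) (cv x w (cst b)) (cv x w (cst z)) (w *m Phi x) => na nb nz p.
by apply/rowP => j; rewrite !mxE; ring.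
Qed.

Lemma eta_constant_rigidity x (c : 'rV[R]_4 -> R) : U x -> differentiable c x ->
  (\near x, eta_constant x (c x)) -> c x != 0 ->
  [/\ (\tr (Phi x) / 3) ^+ 2 = 1,
      forall v, v *m Phi x = (\tr (Phi x) / 3) *: hproj (Xi x) (Eta x) v
    & forall v, 'D_v c x = 2 * (\tr (Phi x) / 3) * c x * ee x v].
Proof.
move=> Ux dc ec c0.
apply: (bianchi_rigidity (GC Ux) (Gu Ux) (hxi Ux) (hphi2 Ux) (hgphi Ux) c0).
- by move=> u v; rewrite !deriveE// linearD.
- by move=> a u; rewrite !deriveE// linearZ.
move=> w a b z.
have C s u v : cv x s (fun y => rm y u v z) - rm x u v (cv x s (cst z)) =
  cov_hwedge (G x) (Phi x) (Xi x) (Eta x) (c x) (fun v => 'D_v c x) s u v z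
  + rm x (cv x s (cst u)) v z + rm x u (cv x s (cst v)) z.
  have E : cv x s (fun y => rm y u v z) =
      cv x s (fun y => wedge (G y) u v z + c y *: hwedge (G y) (Xi y) (Eta y) u v z).
    by apply: cov_near; apply: filterS ec => y ey; exact: ey.
  have ex := nbhs_singleton ec.
  rewrite E (cov_eta_constant s u v z Ux dc) !ex.
  by rewrite addrK.
have := etrans (esym (congr2 +%R (congr2 +%R (C w a b) (C a b w)) (C b w a)))
  (bianchi2 oU sGam a b w z Ux).
(* Derivatives of [z] are already gone. Those of [a], [b] and [w] cancel in pairs, by vanishing
   torsion and skew symmetry of the curvature. *)
rewrite (cov_cstC w a Ux) (cov_cstC b w Ux) (cov_cstC b a Ux).
rewrite (curvature_at_skew oU sGam b (cv x a (cst w)) z Ux).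
rewrite (curvature_at_skew oU sGam a (cv x w (cst b)) z Ux).
rewrite (curvature_at_skew oU sGam w (cv x a (cst b)) z Ux) => <-.
have cancel (p q r n1 n2 n3 : 'rV[R]_4) :
    p + q + r = p + n1 - n2 + (q + n3 - n1) + (r + n2 - n3).
  by apply/rowP => j; rewrite !mxE; ring.
exact: cancel.
Qed.

Lemma ricci_eta_constant x c u v : U x -> eta_constant x c ->
  ricci Gam x u v = 3 * gg x u v + 2 * c * hmet (G x) (Eta x) u v.
Proof.
move=> Ux ec; rewrite /ricci.
rewrite (@ricciE _ (rm x) _ _ _ _ _ (ricci_mx Gam x) erefl); last 5 first.
- by move=> x1 x2 y z; exact: (curvature_atDl oU sGam x1 x2 y z Ux).
- by move=> a y z w; exact: (curvature_atZl oU sGam a y z w Ux).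
- by move=> y z w w'; exact: (curvature_atDr oU sGam y z w w' Ux).
- by move=> a y z w; exact: (curvature_atZr oU sGam a y z w Ux).
- by move=> y z w; exact: (curvature_at_skew oU sGam y z w Ux).
have hp := hmetE (GC Ux) (hxi Ux) (hphi2 Ux) (hgphi Ux).
transitivity (\sum_(k < 4) (gg x u v * ebase R k 0 k - gg x (ebase R k) v * u 0 k
   + c * (hmet (G x) (Eta x) u v * hproj (Xi x) (Eta x) (ebase R k) 0 k
    - hmet (G x) (Eta x) (ebase R k) v * hproj (Xi x) (Eta x) u 0 k))).
  apply: eq_bigr => k _; rewrite ec /wedge /hwedge.
  move: (hproj _ _ _) (hproj _ _ u) => p q; rewrite !mxE; ring.
rewrite big_split/= -mulr_sumr !sumrB -!mulr_sumr sum_ebase contract_bilin.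
rewrite (contract_hproj (hxi Ux)) contract_hmet [hmet _ _ (hproj _ _ _) _]hp.
by rewrite hproj_id ?(form1_hproj (hxi Ux))// -hp; ring.
Qed.

Lemma smooth_ricci u v : smooth_on U (fun x => ricci Gam x u v).
Proof.
apply: smooth_bilin => //; apply/(smooth_mxP oU) => p q.
apply: (@smooth_ext _ _ _ oU _ (fun x => \sum_k rm x (ebase R k) (ebase R p)
    (ebase R q) 0 k)).
  by move=> x _; rewrite mxE.
apply: smooth_sum => // k; apply: smooth_coord => //.
exact: smooth_curvature_at.
Qed.

(** Near [x] the formula for the Ricci tensor can be solved for [c], and everything else in it is
    smooth. *)
Lemma eta_constant_differentiable (c : 'rV[R]_4 -> R) x u : U x ->
  (forall y, U y -> eta_constant y (c y)) -> hmet (G x) (Eta x) u u != 0 ->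
  differentiable c x.
Proof.
move=> Ux ec h0; pose h y := hmet (G y) (Eta y) u u.
have dg : differentiable (fun y => gg y u u) x.
  exact: smooth_differentiable (smooth_bilin oU sG (sc u) (sc u)) Ux.
have de : differentiable (fun y => ee y u) x.
  exact: smooth_differentiable (smooth_form1 (sc u)) Ux.
have dh : differentiable h x by apply: differentiableD => //; exact: differentiableM.
have dr : differentiable (fun y => ricci Gam y u u) x.
  exact: smooth_differentiable (smooth_ricci u u) Ux.
have near_h : \near x, h x != 0.
  have ch := differentiable_continuous dh.
  exact: cvgr_neq0 ch h0.
apply: (@near_eq_differentiable _ _ _ (fun y =>
    (ricci Gam y u u - 3 * gg y u u) * (2 * h y)^-1)).
  have nU : \near x, U x by exact: open_nbhs_nbhs.
  apply: filterS2 near_h nU => y hy Uy.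
  rewrite (ricci_eta_constant u u Uy (ec y Uy)) -/(h y); field.
  exact: hy.
apply: differentiableM.
  by apply: differentiableB => //; apply: differentiableM => //;
      exact: differentiable_cst.
apply: differentiableV; first by apply: differentiableM => //;
    exact: differentiable_cst.
by rewrite mulf_neq0// pnatr_eq0.
Qed.
End LPSasakian.

(** * Curves *)

Section CovariantDerivativeAlong.
Variables (R : realType) (n : nat).
Variable Gam : 'rV[R]_n -> 'I_n -> 'I_n -> 'rV[R]_n.
Variable c : R^o -> 'rV[R]_n.
Implicit Types (V W : R^o -> 'rV[R]_n) (t : R^o).

Definition cov_along V : R^o -> 'rV[R]_n :=
  fun t => 'D_1 V t + christoffel (Gam (c t)) ('D_1 c t) (V t).

Lemma cov_along_eq (J : set R^o) V W t : open J -> J t ->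
  (forall s, J s -> V s = W s) -> cov_along V t = cov_along W t.
Proof.
move=> oJ Jt VW; have nVW : \near t, V t = W t by exact: eq_on_near VW Jt.
by rewrite /cov_along (near_eq_derive _ nVW) VW.
Qed.

Lemma cov_alongD V W t : derivable V t 1 -> derivable W t 1 ->
  cov_along (fun s => V s + W s) t = cov_along V t + cov_along W t.
Proof.
move=> dV dW; rewrite /cov_along christoffelDr.
have -> : 'D_1 (fun s => V s + W s) t = 'D_1 V t + 'D_1 W t by exact: deriveD.
by rewrite addrACA.
Qed.

Lemma derivable_scale_along (f : R^o -> R) V t : derivable f t 1 -> derivable V t 1 ->
  derivable (fun s => f s *: V s) t 1.
Proof.
move=> df dV; apply: (derivable_mxP _ t 1).2 => i j.
have -> : (fun y => (f y *: V y) i j) = f * (fun y => V y i j).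
  by apply/funext => y; rewrite mxE.
exact: derivableM df ((derivable_mxP V t 1).1 dV i j).
Qed.

Lemma cov_alongZ (f : R^o -> R) V t : derivable f t 1 -> derivable V t 1 ->
  cov_along (fun s => f s *: V s) t = 'D_1 f t *: V t + f t *: cov_along V t.
Proof.
move=> df dV; rewrite /cov_along christoffelZr scalerDr addrA; congr (_ + _).
have M i j : (fun y => (f y *: V y) i j) = f * (fun y => V y i j).
  by apply/funext => y; rewrite mxE.
have dVij i j : derivable (fun y => V y i j) t 1.
  exact: ((derivable_mxP V t 1).1 dV i j).
rewrite (derive_mx (derivable_scale_along df dV)) (derive_mx dV).
apply/matrixP => i j; rewrite !mxE M.
rewrite (deriveM df (dVij i j)) addrC; congr (_ + _); exact: mulrC.
Qed.

Lemma is_derive_along (f : 'rV[R]_n -> R) t : differentiable f (c t) ->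
    differentiable c t ->
  is_derive t 1 (fun s => f (c s)) ('D_('D_1 c t) f (c t)).
Proof.
move=> df dc; have dfc := differentiable_comp dc df.
apply: DeriveDef; first exact: diff_derivable dfc.
rewrite (deriveE _ dfc) (diff_comp dc df) /= -(deriveE _ dc).
by rewrite -(deriveE _ df).
Qed.
End CovariantDerivativeAlong.

Section SmoothAlong.
Variables (R : realType) (n : nat) (U : set 'rV[R]_n).
Variable Gam : 'rV[R]_n -> 'I_n -> 'I_n -> 'rV[R]_n.
Variables (J : set R^o) (c : R^o -> 'rV[R]_n).
Hypotheses (oU : open U) (oJ : open J).
Hypothesis sGam : forall k l, smooth_on U (fun x => Gam x k l).
Hypothesis sc : smooth_on J c.
Hypothesis cU : forall s, J s -> U (c s).

Lemma smooth_cov_along (V : R^o -> 'rV[R]_n) : smooth_on J V ->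
    smooth_on J (cov_along Gam c V).
Proof.
move=> sV; apply: smoothD => //; first exact: smooth_derive.
have sv : smooth_on J ('D_1 c) by exact: smooth_derive.
apply: smooth_sum => // k; apply: smooth_sum => // l; apply: smoothZ => //.
  apply: smoothM => //; [exact: (smooth_mxP oJ _).1 sv 0 k|exact: (smooth_mxP oJ
      _).1 sV 0 l].
apply/(smooth_mxP oJ) => i j m.
have /(smooth_mxP oU) sg := sGam k l.
exact: (Ck_comp oJ cU (sc m) (sg i j m)).
Qed.
End SmoothAlong.

(** * Orthonormal frames with one timelike vector *)

Section PseudoOrthonormalFrame.
Variables (R : realType) (G : 'M[R]_4) (t n b1 b2 : 'rV[R]_4).
Local Notation g := (bilin G).
Hypothesis GC : G^T = G.
Hypotheses (gtt : g t t = 1) (gnn : g n n = -1) (g11 : g b1 b1 = 1) (g22 : g b2 b2 = 1).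
Hypotheses (gtn : g t n = 0) (gt1 : g t b1 = 0) (gt2 : g t b2 = 0).
Hypotheses (gn1 : g n b1 = 0) (gn2 : g n b2 = 0) (g12 : g b1 b2 = 0).

Lemma frame_complete v : g v t = 0 -> g v n = 0 -> g v b1 = 0 -> g v b2 = 0 -> v = 0.
Proof.
move=> vt vn v1 v2.
pose fr (i : 'I_4) := nth 0 [:: t; n; b1; b2] i.
pose F := \matrix_i fr i.
(* The diagonal of the Gram matrix of the frame: the timelike [n] stands at index 1 of the list. *)
pose d : 'rV[R]_4 := \row_i (if i == 1 :> nat then -1 else 1).
have FGF : F *m (G *m F^T *m diag_mx d) = 1%:M.
  apply/matrixP => i j; rewrite !mulmxA mul_mx_diag mxE.
  have -> : (F *m G *m F^T) i j = g (fr i) (fr j).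
    rewrite /bilin !mxE; apply: eq_bigr => k _; rewrite !mxE; congr (_ * _).
    by apply: eq_bigr => l _; rewrite !mxE.
  have S i' j' : g (fr i') (fr j') = if i' == j' then d 0 i' else 0.
    rewrite /d /fr mxE; case: i' => -[|[|[|[|//]]]] ?; case: j' => -[|[|[|[|//]]]] ? /=;
      rewrite -?(inj_eq val_inj) /= ?gtt ?gnn ?g11 ?g22 ?gtn ?gt1 ?gt2 ?gn1 ?gn2
          ?g12 //;
      by rewrite (bilinC _ _ GC) ?gtn ?gt1 ?gt2 ?gn1 ?gn2 ?g12.
  rewrite S !mxE; case: eqP => [->|_]; last by rewrite mul0r.
  by case: ifP; rewrite ?mulr1 ?mulrNN ?mulr1.
have vF : v *m (G *m F^T) = 0.
  apply/rowP => j; have -> : (v *m (G *m F^T)) 0 j = g v (fr j).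
    rewrite mulmxA /bilin !mxE; apply: eq_bigr => k _; rewrite !mxE.
    by congr (_ * _); apply: eq_bigr.
  by rewrite mxE; case: j => -[|[|[|[|//]]]] ?.
by rewrite -(mulmx1 v) -(mulmx1C FGF) !mulmxA -(mulmxA v) vF !mul0mx.
Qed.

(** Applied to [xi], this is the quadratic relation between the values of [eta] on the four frame
    vectors. *)
Lemma frame_norm x :
  g x t * g x t - g x n * g x n + g x b1 * g x b1 + g x b2 * g x b2 = g x x.
Proof.
pose y := g x t *: t - g x n *: n + g x b1 *: b1 + g x b2 *: b2.
have E : x - y = 0.
  by apply: frame_complete; rewrite /y !(bilinDl, bilinNl, bilinZl)
    ?[g n t]bilinC// ?[g b1 t]bilinC// ?[g b1 n]bilinC//
    ?[g b2 t]bilinC// ?[g b2 n]bilinC// ?[g b2 b1]bilinC//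
    ?gtt ?gnn ?g11 ?g22 ?gtn ?gt1 ?gt2 ?gn1 ?gn2 ?g12; ring.
have -> : g x x = g x y by congr bilin; apply/eqP; rewrite -subr_eq0 E.
by rewrite /y !(bilinDr, bilinNr, bilinZr); ring.
Qed.
End PseudoOrthonormalFrame.

(** * The biharmonic equation in Frenet components *)

Section FrenetCurve.
#[local] Opaque curvature_at bilin hproj.
Variables (R : realType) (U : set 'rV[R]_4).
Variables (Gam : 'rV[R]_4 -> 'I_4 -> 'I_4 -> 'rV[R]_4).
Variables (G Phi : 'rV[R]_4 -> 'M[R]_4) (Xi : 'rV[R]_4 -> 'rV[R]_4).
Variable Eta : 'rV[R]_4 -> 'cV[R]_4.
Variable Cf : 'rV[R]_4 -> R.
Local Notation gg x := (bilin (G x)).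
Local Notation ee x := (form1 (Eta x)).
Hypothesis GC : forall x, U x -> (G x)^T = G x.
Hypothesis e_xi : forall x, U x -> ee x (Xi x) = -1.
Hypothesis phi2 : forall x u, U x -> u *m Phi x *m Phi x = u + ee x u *: Xi x.
Hypothesis g_phi : forall x u v, U x ->
  gg x (u *m Phi x) (v *m Phi x) = gg x u v + ee x u * ee x v.
Hypothesis curv : forall x, U x -> forall u v w, curvature_at Gam x u v w =
  wedge (G x) u v w + Cf x *: hwedge (G x) (Xi x) (Eta x) u v w.
Hypothesis dee : forall x u, U x -> differentiable (fun y => ee y u) x.
Hypothesis Dee : forall x u v, U x ->
  'D_v (fun y => ee y u) x = gg x (v *m Phi x) u + ee x (christoffel (Gam x) v u).
Hypothesis dtr : forall x, U x -> differentiable (fun y => \tr (Phi y) / 3) x.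
Hypothesis dCf : forall x u, U x -> hmet (G x) (Eta x) u u != 0 -> differentiable Cf x.
Hypothesis rigidity : forall x, U x -> differentiable Cf x -> Cf x != 0 ->
  [/\ (\tr (Phi x) / 3) ^+ 2 = 1,
      forall v, v *m Phi x = (\tr (Phi x) / 3) *: hproj (Xi x) (Eta x) v
    & forall v, 'D_v Cf x = 2 * (\tr (Phi x) / 3) * Cf x * ee x v].

Variables (J : set R^o) (c N B1 B2 : R^o -> 'rV[R]_4) (k1 k2 k3 : R^o -> R).
Hypothesis oJ : open J.
Hypothesis cU : forall s, J s -> U (c s).
Hypothesis dc : forall s, J s -> differentiable c s.
Let T : R^o -> 'rV[R]_4 := 'D_1 c.
Hypotheses (dT : forall s, J s -> derivable T s 1)
  (dN : forall s, J s -> derivable N s 1) (dB1 : forall s, J s -> derivable B1 s 1)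
  (dB2 : forall s, J s -> derivable B2 s 1).
Hypotheses (dk1 : forall s, J s -> derivable k1 s 1)
  (ddk1 : forall s, J s -> derivable ('D_1 k1) s 1)
  (dk2 : forall s, J s -> derivable k2 s 1).
Local Notation g s := (bilin (G (c s))).
Hypotheses (gTT : forall s, J s -> g s (T s) (T s) = 1)
  (gNN : forall s, J s -> g s (N s) (N s) = -1)
  (gB1B1 : forall s, J s -> g s (B1 s) (B1 s) = 1)
  (gB2B2 : forall s, J s -> g s (B2 s) (B2 s) = 1)
  (gTN : forall s, J s -> g s (T s) (N s) = 0)
  (gTB1 : forall s, J s -> g s (T s) (B1 s) = 0)
  (gTB2 : forall s, J s -> g s (T s) (B2 s) = 0)
  (gNB1 : forall s, J s -> g s (N s) (B1 s) = 0)
  (gNB2 : forall s, J s -> g s (N s) (B2 s) = 0)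
  (gB1B2 : forall s, J s -> g s (B1 s) (B2 s) = 0).
Local Notation D V := (cov_along Gam c V).
Hypotheses (DT : forall s, J s -> D T s = k1 s *: N s)
  (DN : forall s, J s -> D N s = k1 s *: T s + k2 s *: B1 s)
  (DB1 : forall s, J s -> D B1 s = k2 s *: N s + k3 s *: B2 s)
  (DB2 : forall s, J s -> D B2 s = - k3 s *: B1 s).
Hypothesis biharm : forall s, J s ->
  D (D (D T)) s = curvature_at Gam (c s) (T s) (D T s) (T s).
Hypothesis k1_neq0 : forall s, J s -> k1 s != 0.

(** [V] lives on the curve only, so the formula for [nabla eta] is applied to the constant basis
    fields and combined with the components of [V] by the product rule. *)
Lemma derive_form1_along V s : J s -> derivable V s 1 ->
  is_derive s 1 (fun r => ee (c r) (V r))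
    (g s (T s *m Phi (c s)) (V s) + ee (c s) (D V s)).
Proof.
move=> Js dV.
have dVk k : is_derive s 1 (fun r => V r 0 k) ('D_1 V s 0 k).
  have dVk : derivable (fun r => V r 0 k) s 1 := (derivable_mxP V s 1).1 dV 0 k.
  by apply: DeriveDef dVk _; rewrite (derive_mx dV) mxE.
have dek k := is_derive_along (dee (ebase R k) (cU Js)) (dc Js).
have H := is_derive_sum (fun k : 'I_4 => is_deriveM (dek k) (dVk k)).
have -> : (fun r => ee (c r) (V r)) = \sum_k ((fun r => ee (c r)
    (ebase R k)) * (fun r => V r 0 k)).
  by apply/funext => r; rewrite fct_sumE -(contract_form1 (Eta (c r)) (V r)).
apply: is_derive_eq H _.
have gC := bilinC _ _ (GC (cU Js)).
rewrite /cov_along form1D -(contract_form1 (Eta (c s)) ('D_1 V s)).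
have cl (l : 'rV[R]_4 -> R) u : (forall v w, l (v + w) = l v + l w) ->
  (forall a v, l (a *: v) = a * l v) -> l u = \sum_k l (ebase R k) * u 0 k.
  by move=> lD lZ; rewrite contract_linear.
rewrite (cl (fun v => g s (T s *m Phi (c s)) v)); last 2 first.
- by move=> *; rewrite bilinDr.
- by move=> *; rewrite bilinZr.
rewrite (cl (fun v => ee (c s) (christoffel (Gam (c s)) ('D_1 c s) v))); last 2 first.
- by move=> *; rewrite christoffelDr form1D.
- by move=> *; rewrite christoffelZr form1Z.
rewrite -!big_split; apply: eq_bigr => k _ /=.
rewrite (Dee (ebase R k) ('D_1 c s) (cU Js)).
have reorder (p q r x y : R) : p * q + r * (x + y) = x * r + (p * q + y * r) by ring.
exact: reorder.
Qed.

Lemma frenet_DDT s : J s ->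
  D (D T) s = 'D_1 k1 s *: N s + (k1 s * k1 s) *: T s + (k1 s * k2 s) *: B1 s.
Proof.
move=> Js; rewrite (cov_along_eq (W := fun r => k1 r *: N r) Gam c oJ Js DT).
rewrite (cov_alongZ _ _ (dk1 Js) (dN Js)) DN// scalerDr !scalerA addrA.
by [].
Qed.

Lemma frenet_DDDT s : J s -> D (D (D T)) s =
  (3 * k1 s * 'D_1 k1 s) *: T s
  + ('D_1 ('D_1 k1) s + k1 s * k1 s * k1 s + k1 s * k2 s * k2 s) *: N s
  + (2 * 'D_1 k1 s * k2 s + k1 s * 'D_1 k2 s) *: B1 s + (k1 s * k2 s * k3 s) *: B2 s.
Proof.
move=> Js; have dk11 := derivableM (dk1 Js) (dk1 Js).
have dk12 := derivableM (dk1 Js) (dk2 Js).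
pose W r := 'D_1 k1 r *: N r + (k1 * k1) r *: T r + (k1 * k2) r *: B1 r.
rewrite (cov_along_eq (W := W) Gam c oJ Js (fun r Jr => frenet_DDT Jr)).
have d1 := derivable_scale_along (ddk1 Js) (dN Js).
have d2 := derivable_scale_along dk11 (dT Js).
have d3 := derivable_scale_along dk12 (dB1 Js).
rewrite (cov_alongD _ _ (derivableD d1 d2) d3) (cov_alongD _ _ d1 d2).
rewrite (cov_alongZ _ _ (ddk1 Js) (dN Js)) (cov_alongZ _ _ dk11 (dT Js)).
rewrite (cov_alongZ _ _ dk12 (dB1 Js)) DN// DT// DB1//.
rewrite (deriveM (dk1 Js) (dk1 Js)) (deriveM (dk1 Js) (dk2 Js)).
apply/rowP => j; rewrite !mxE.
have reorder (n t b1 b2 x y z k k' k'' : R) :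
  k'' * n + k' * (k * t + x * b1) + ((k * k' + k * k') * t
    + (k * k) * (k * n)) + ((k * z + x * k') * b1 + (k * x) * (x * n + y * b2)) =
  3 * k * k' * t + (k'' + k * k * k + k * x * x) * n + (2 * k' * x + k * z) * b1
    + (k * x * y) * b2 by ring.
exact: reorder.
Qed.

Lemma frenet_curve_not_biharmonic s : J s -> False.
Proof.
pose al r := ee (c r) (T r); pose be r := ee (c r) (N r).
pose b r := ee (c r) (B1 r); pose d r := ee (c r) (B2 r).
pose u r := Cf (c r); pose f r := \tr (Phi (c r)) / 3.
have hP r x y (Jr : J r) : g r (hproj (Xi (c r)) (Eta (c r)) x) y =
    g r x y + ee (c r) x * ee (c r) y.
  have Ux := cU Jr.
  by rewrite -(hmetE (GC Ux) (e_xi Ux) (fun v => phi2 v Ux) (fun v w => g_phi v w Ux)).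
have hX r w (Jr : J r) : g r (Xi (c r)) w = ee (c r) w.
  have Ux := cU Jr; rewrite (bilinC _ _ (GC Ux)).
  by rewrite (bilin_xi (e_xi Ux) (fun v => phi2 v Ux) (fun v w => g_phi v w Ux)).
have frame r : J r -> be r * be r = 1 + al r * al r + (b r * b r + d r * d r).
  move=> Jr; have Ux := cU Jr.
  have := frame_norm (GC Ux) (gTT Jr) (gNN Jr) (gB1B1 Jr) (gB2B2 Jr) (gTN Jr) (gTB1 Jr)
    (gTB2 Jr) (gNB1 Jr) (gNB2 Jr) (gB1B2 Jr) (Xi (c r)).
  by rewrite !hX// (e_xi Ux) /al /be /b /d; lra.
(* The biharmonic equation paired with [w]. On the right stands the curvature term, with
   [g(N, T) = 0] and [g(T, T) = 1] inserted; taking each frame vector for [w] yields the four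
   component equations. *)
have pairing r w : J r ->
  3 * k1 r * 'D_1 k1 r * g r (T r) w
  + ('D_1 ('D_1 k1) r + k1 r * k1 r * k1 r + k1 r * k2 r * k2 r) * g r (N r) w
  + (2 * 'D_1 k1 r * k2 r + k1 r * 'D_1 k2 r) * g r (B1 r) w
  + k1 r * k2 r * k3 r * g r (B2 r) w =
  k1 r * (- g r (N r) w + u r * (al r * be r * (g r (T r) w + al r * ee (c r) w)
    - (1 + al r * al r) * (g r (N r) w + be r * ee (c r) w))).
  move=> Jr; have := biharm Jr; rewrite (frenet_DDDT Jr) (DT Jr) (curv (cU Jr)).
  move=> /(congr1 (fun v => g r v w)) E.
  rewrite !(bilinDl, bilinZl) in E; rewrite E /wedge /hwedge /hmet.
  rewrite !(bilinDl, bilinZl, bilinNl) !hX// !form1Z (gTT Jr).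
  rewrite (bilinC (N r) (T r) (GC (cU Jr))) (gTN Jr) -/(al r) -/(be r) -/(u r).
  ring.
have dk0 r : J r -> 'D_1 k1 r = 0.
  move=> Jr; have := pairing r (T r) Jr.
  rewrite (gTT Jr) (bilinC (N r) _ (GC (cU Jr))) (gTN Jr)
      (bilinC (B1 r) _ (GC (cU Jr))) (gTB1 Jr).
  rewrite (bilinC (B2 r) _ (GC (cU Jr))) (gTB2 Jr) -/(al r) => E.
  by apply: (mulfI (k1_neq0 Jr)); move: E; lra.
have ddk0 r : J r -> 'D_1 ('D_1 k1) r = 0.
  move=> Jr; rewrite -[RHS](derive_cst (0 : R) r (1 : R^o)).
  by apply: near_eq_derive; exact: eq_on_near oJ dk0 Jr.
have normal1 r : J r -> k1 r * k1 r + k2 r * k2 r + 1 = u r * (b r * b r + d r * d r).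
  move=> Jr; have := pairing r (N r) Jr.
  rewrite (gTN Jr) (gNN Jr) (bilinC (B1 r) _ (GC (cU Jr))) (gNB1 Jr).
  rewrite (bilinC (B2 r) _ (GC (cU Jr))) (gNB2 Jr) -/(be r) (dk0 r Jr) (ddk0 r Jr) => E.
  apply: (mulfI (k1_neq0 Jr)).
  have -> : b r * b r + d r * d r = be r * be r - 1 - al r * al r by rewrite
      frame//; ring.
  by move: E; lra.
have normal2 r : J r -> 'D_1 k2 r = - u r * be r * b r.
  move=> Jr; have := pairing r (B1 r) Jr.
  rewrite (gTB1 Jr) (gNB1 Jr) (gB1B1 Jr).
  rewrite (bilinC (B2 r) _ (GC (cU Jr))) (gB1B2 Jr) -/(b r) (dk0 r Jr) => E.
  by apply: (mulfI (k1_neq0 Jr)); move: E; lra.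
have normal3 r : J r -> k2 r * k3 r = - u r * be r * d r.
  move=> Jr; have := pairing r (B2 r) Jr.
  rewrite (gTB2 Jr) (gNB2 Jr) (gB1B2 Jr) (gB2B2 Jr) -/(d r) => E.
  by apply: (mulfI (k1_neq0 Jr)); move: E; lra.
(* The N-component needs no derivative of [Cf], so it can be used to exclude [u = 0] before the
   rigidity statement is invoked. *)
have u0 r : J r -> u r != 0.
  move=> Jr; apply/eqP => u0; have := normal1 r Jr; rewrite u0 mul0r.
  by have := sqr_ge0 (k1 r); have := sqr_ge0 (k2 r); rewrite !expr2; lra.
have h0 r : J r -> hmet (G (c r)) (Eta (c r)) (T r) (T r) != 0.
  move=> Jr; rewrite /hmet (gTT Jr) -/(al r) gt_eqF// ltr_pwDl// -expr2; exact: sqr_ge0.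
have dC r (Jr : J r) := dCf (cU Jr) (h0 r Jr).
have rig r (Jr : J r) := rigidity (cU Jr) (dC r Jr) (u0 r Jr).
have fPhi r x : J r -> x *m Phi (c r) = f r *: hproj (Xi (c r)) (Eta (c r)) x.
  by move=> Jr; have [_ E _] := rig r Jr; exact: E.
have dform V W r : J r -> derivable V r 1 -> D V r = W ->
    is_derive r 1 (fun r => ee (c r) (V r))
      (f r * (g r (T r) (V r) + al r * ee (c r) (V r)) + ee (c r) W).
  move=> Jr dV <-; have := derive_form1_along Jr dV.
  by rewrite (fPhi r _ Jr) bilinZl hP.
move=> Js; apply: (@frenet_system_inconsistent R J s oJ Js al be b d f k1 k2 k3 u
  (fun r => 'D_(T r) (fun y => \tr (Phi y) / 3) (c r))) => // {s Js}.
- by move=> r Jr; exact: is_derive_along (dtr (cU Jr)) (dc Jr).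
- by move=> r Jr; have [E _ _] := rig r Jr; rewrite -expr2.
- by move=> r Jr; rewrite -(dk0 r Jr); exact: derivableP (dk1 Jr).
- by move=> r Jr; rewrite -(normal2 r Jr); exact: derivableP (dk2 Jr).
- move=> r Jr; have [_ _ E] := rig r Jr.
  have -> : 2 * f r * u r * al r = 'D_(T r) Cf (c r) by rewrite E.
  exact: is_derive_along (dC r Jr) (dc Jr).
- move=> r Jr; have := dform T _ r Jr (dT Jr) (DT Jr).
  by rewrite (gTT Jr) form1Z.
- move=> r Jr; have := dform N _ r Jr (dN Jr) (DN Jr).
  by rewrite (gTN Jr) form1D !form1Z add0r mulrA addrA.
- move=> r Jr; have := dform B1 _ r Jr (dB1 Jr) (DB1 Jr).
  by rewrite (gTB1 Jr) form1D !form1Z add0r mulrA addrA.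
- move=> r Jr; have := dform B2 _ r Jr (dB2 Jr) (DB2 Jr).
  by rewrite (gTB2 Jr) form1Z add0r mulrA mulNr.
Qed.
End FrenetCurve.

(** * Intervals that may contain their endpoints *)

Section Interval.
Variable R : realType.

(* A point of a nondegenerate interval may be an endpoint, but it is adherent
   to open subsets of the interval. *)
Lemma interval_adherent (I : set R) (t : R) (W : set R^o) :
  nondegenerate_interval I -> I t -> nbhs (t : R^o) W ->
  exists J : set R^o, [/\ open J, exists s, J s, forall s, J s -> I s,
    forall s, J s -> W s & ~ J t].
Proof.
move=> [itvI [a [b [Ia Ib ab]]]] It /nbhs_ballP[r /= r0 rW].
have [t' It' tt'] : exists2 t', I t' & t' != t.
  have [ta|ta] := eqVneq a t; last by exists a.
  by exists b; rewrite // -ta gt_eqF.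
have d0 : 0 < `|t' - t| by rewrite normr_gt0 subr_eq0.
(* The ball is centred between [t] and [t'], with radius half the distance of its centre [m] from
   [t], so it misses [t]. The first bound on [rho] keeps it between [t] and [t'], the second keeps
   it within [r] of [t]. *)
pose rho := Num.min 2^-1 (r / (2 * `|t' - t|)).
have rho0 : 0 < rho by rewrite /rho lt_min invr_gt0 ltr0n/= divr_gt0// mulr_gt0.
have rho1 : rho <= 2^-1 by rewrite /rho ge_min lexx.
have rho2 : rho * `|t' - t| <= r / 2.
  rewrite -ler_pdivlMr//; apply: le_trans (_ : r / (2 * `|t' - t|) <= _).
    by rewrite /rho ge_min lexx orbT.
  by rewrite invfM mulrA.
pose m := t + rho * (t' - t); pose del := rho / 2 * `|t' - t|.
have del0 : 0 < del by rewrite mulr_gt0// divr_gt0.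
have Jb s : ball (m : R^o) del s -> m - del < s < m + del.
  by rewrite -ball_normE /ball_/= ltr_distlC.
exists (ball (m : R^o) del); split.
- exact: ball_open.
- by exists m; exact: ballxx.
- move=> s /Jb /andP[]; rewrite /m /del.
  have [lt|ge] := ltP t t'.
    rewrite gtr0_norm ?subr_gt0// => s1 s2.
    by apply: (itvI _ _ It It'); nra.
  have lt : t' < t by rewrite lt_neqAle tt'.
  rewrite ltr0_norm ?subr_lt0// => s1 s2.
  by apply: (itvI _ _ It' It); nra.
- move=> s /Jb /andP[s1 s2]; apply: rW; rewrite -ball_normE /ball_/= ltr_distlC.
  have : `|rho * (t' - t)| = rho * `|t' - t| by rewrite normrM (gtr0_norm rho0).
  move: s1 s2 rho2 d0; rewrite /m /del.
  have := ler_norm (rho * (t' - t)); have := ler_norm (- (rho * (t' - t))).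
  rewrite normrN => n1 n2 s1 s2 rho2 d0 nE; rewrite nE in n1 n2.
  have p0 : 0 < rho * `|t' - t| by rewrite mulr_gt0.
  move: (rho * (t' - t)) (`|t' - t|) n1 n2 s1 s2 rho2 p0 => x y; lra.
- rewrite -ball_normE /ball_/= /m addrAC subrr add0r normrM (gtr0_norm rho0).
  rewrite /del; move: (`|t' - t|) d0 => y y0; apply/negP; rewrite -leNgt; nra.
Qed.

(** At an endpoint [F] vanishes on one side only. As the derivative exists, its difference quotients
    at points of [I] distinct from [t] suffice, and these are zero. *)
Lemma derive_zero_on_interval (n : nat) (I : set R) (W : set R^o) (F : R^o ->
    'rV[R]_n) (t : R) :
  nondegenerate_interval I -> I t -> nbhs (t : R^o) W -> derivable F t 1 ->
  (forall s, I s -> W s -> F s = 0) -> 'D_1 F t = 0.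
Proof.
move=> ndI It Wt dF F0; apply/eqP; apply: contraT => D0.
have e0 : 0 < `|'D_1 F t| / 2 by rewrite divr_gt0// normr_gt0.
have /cvgrPdist_lt/(_ _ e0) := dF.
rewrite near_withinE => /nbhs_ballP[r /= r0 H].
have Wb : nbhs (t : R^o) (W `&` ball (t : R^o) r).
  by apply: filterI => //; exact: nbhsx_ballx.
have [J [_ [s Js] JI JW nJt]] := interval_adherent ndI It Wb.
have [Ws bs] := JW s Js.
have st : s - t != 0 by rewrite subr_eq0; apply/eqP => st; apply: nJt; rewrite -st.
have b0 : ball (0 : R^o) r (s - t).
  by move: bs; rewrite -!ball_normE /ball_/= sub0r normrN distrC.
have : `|'D_1 F t - (s - t)^-1 *: (F ((s - t)%:A + t) - F t)| < `|'D_1 F t| / 2.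
  exact: H b0 st.
have -> : (s - t)%:A + t = s by rewrite /GRing.scale/= mulr1 subrK.
have d0 : 0 < `|'D_1 F t| by rewrite normr_gt0.
move: ('D_1 F t) d0 => d d0.
rewrite (F0 s (JI s Js) Ws) (F0 t It (nbhs_singleton Wt)) subrr scaler0 subr0.
by move: (`|d|) d0 => y; lra.
Qed.
End Interval.

(** * Passage from the manifold to a chart *)

Section Chart.
Variables (R : realType) (M : manifold R 4).
Variables (phi : endo_field M) (xi : vector_field M) (eta : one_form M).
Variables (g : lorentz_metric M) (D : connection M).
Hypothesis hM : is_LP_sasakian g D phi xi eta.
Variable i : chart_ix M.
Local Notation U := (@chart_img R 4 M i).

Lemma chart_img_open : open U. Proof. exact: chart_image_open. Qed.

Lemma minkowski_unit : minkowski_mx R 4 \in unitmx.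
Proof.
pose d : 'rV[R]_4 := \row_j (if j == 0%N :> nat then -1 else 1).
have E : minkowski_mx R 4 *m minkowski_mx R 4 = 1%:M.
  rewrite /minkowski_mx; apply/matrixP => j k; rewrite mul_diag_mx !mxE.
  have [_|_] := eqVneq j k; case: ifP => _;
    by rewrite ?mulr1n ?mulr0n ?mulr0 ?mulrNN ?mulr1.
by have [] := mulmx1_unit E.
Qed.

Lemma metric_unit x : U x -> g i x \in unitmx.
Proof.
move=> Ux; have [P _ E] := lm_signature g Ux.
by have := minkowski_unit; rewrite -E !unitmx_mul => /andP[/andP[_ ->]].
Qed.

Lemma chart_torsion_free (X Y : field R 4) x : smooth_on U X -> smooth_on U Y -> U x ->
  nabla (D i) X Y x - nabla (D i) Y X x = lie_bracket X Y x.
Proof. by move=> sX sY Ux; have [H _] := lp_levi_civita hM sX sY; exact: H. Qed.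

Lemma chart_metric (X Y Z : field R 4) x :
  smooth_on U X -> smooth_on U Y -> smooth_on U Z -> U x ->
  'D_(Z x) (fun z => bilin (g i z) (X z) (Y z)) x =
  bilin (g i x) (nabla (D i) Z X x) (Y x) + bilin (g i x) (X x) (nabla (D i) Z Y x).
Proof. by move=> sX sY sZ Ux; have [_ H] := lp_levi_civita hM sX sY; exact: H. Qed.

Lemma chart_nabla_phi (X Y : field R 4) x : smooth_on U X -> smooth_on U Y -> U x ->
  nabla_endo (D i) (phi i) X Y x =
  bilin (g i x) (X x *m phi i x) (Y x *m phi i x) *: xi i x
  + form1 (eta i x) (Y x) *: (X x *m phi i x *m phi i x).
Proof. by move=> sX sY Ux; exact: (lp_nabla_phi hM). Qed.

Let oU := chart_img_open.
Let sGam k l : smooth_on U (fun x => D i x k l). Proof. exact: cn_smooth. Qed.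
Let sG : smooth_on U (g i). Proof. exact: lm_smooth. Qed.
Let sPhi : smooth_on U (phi i). Proof. exact: ef_smooth. Qed.
Let sXi : smooth_on U (xi i). Proof. exact: vf_smooth. Qed.
Let sEta : smooth_on U (eta i). Proof. exact: of_smooth. Qed.
Let GC x : U x -> (g i x)^T = g i x. Proof. exact: lm_sym. Qed.
Let e_xi x : U x -> form1 (eta i x) (xi i x) = -1. Proof. exact: (lp_eta_xi hM). Qed.
Let phi2 x u : U x -> u *m phi i x *m phi i x = u + form1 (eta i x) u *: xi i x.
Proof. exact: (lp_phi2 hM). Qed.
Let g_phi x u v : U x -> bilin (g i x) (u *m phi i x) (v *m phi i x) =
  bilin (g i x) u v + form1 (eta i x) u * form1 (eta i x) v.
Proof. exact: (lp_compat hM). Qed.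

Lemma chart_eta_constant x : U x ->
  conformally_flat g D \/ quasi_conformally_flat g D \/ conformally_symmetric g D ->
  exists c, eta_constant (D i) (g i) (xi i) (eta i) x c.
Proof.
move=> Ux; have sc (w : 'rV[R]_4) : smooth_on U (fun=> w) by exact: smooth_cst.
have quasi := @eta_constant_of_quasi R U (D i) (g i) (phi i) (xi i)
    (eta i) oU sGam sG sXi
  GC metric_unit chart_torsion_free chart_metric e_xi phi2 g_phi chart_nabla_phi x Ux.
case=> [flat|[[a [b [ab0 qflat]]]|sym]].
(* For [n = 4] the conformal tensor has the quasi-conformal shape with [a = 1], [b = - 1/2], and its
   scalar term corresponds to [s = - r/6]. *)
- apply: (quasi 1 (- 2^-1) (- (scalar_curv (D i) (g i) x / 6))).
  + exact: oner_neq0.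
  + by rewrite oppr_eq0 invr_eq0 pnatr_eq0.
  move=> u v w; have := flat i (fun=> u) (fun=> v) (fun=> w) x (sc u) (sc v) (sc w) Ux.
  rewrite (conformal_curvE (g i) oU sGam Ux (sc u) (sc v) (sc w)) => E.
  rewrite -[RHS]E; move: (u *m ricci_op _ _ _) (v *m ricci_op _ _ _) => p q.
  move: (curvature_at _ _ _ _ _) (ricci _ _ _ _) (ricci _ _ _ _) => r s1 s2.
  move: (scalar_curv _ _ _) => r'; rewrite /wedge.
  move: (bilin _ _ _) (bilin _ _ _) => g1 g2.
  by apply/rowP => j; rewrite !mxE; ring.
- have [a0 b0] : a != 0 /\ b != 0 by apply/andP; rewrite -negb_or -mulf_eq0.
  apply: (quasi a b _ a0 b0) => u v w.
  exact: (qflat i (fun=> u) (fun=> v) (fun=> w) x (sc u) (sc v) (sc w) Ux).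
- apply: (@eta_constant_of_symmetric R U (D i) (g i) (phi i) (xi i)
    (eta i) oU sGam sG sPhi sXi
    GC metric_unit chart_torsion_free chart_metric e_xi phi2 g_phi
        chart_nabla_phi x Ux).
  by move=> W X Y Z y sW sX sY sZ Uy; exact: sym.
Qed.

Section Curve.
Variables (I : set R) (gamma : R -> M).
Hypothesis hI : nondegenerate_interval I.
Hypothesis hgamma : smooth_curve I gamma.
Local Notation c := (chart i \o gamma : R^o -> 'rV[R]_4).

(** The geodesic equation holds on [I] only, so it cannot simply be differentiated at an endpoint;
    [derive_zero_on_interval] carries the vanishing through the two further covariant
    derivatives. *)
Lemma geodesic_biharmonic t : is_geodesic D I gamma -> I t -> chart_dom i (gamma t) ->
  nablaT D gamma (nablaT D gamma (nablaT D gamma (velocity gamma))) i t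
  - curvature_at (D i) (c t) (velocity gamma i t) (nablaT D gamma (velocity gamma) i t)
      (velocity gamma i t) = 0.
Proof.
move=> geo It dt; have [W [[oW Wt] Wdom sc]] := hgamma It dt.
have cU s : W s -> U (c s) by move=> Ws; exists (gamma s) => //; exact: Wdom.
pose F0 := velocity gamma i; pose F1 := cov_along (D i) c F0.
pose F2 := cov_along (D i) c F1; pose F3 := cov_along (D i) c F2.
have s0 : smooth_on W F0 by exact: smooth_derive.
have s1 : smooth_on W F1 := smooth_cov_along oU oW sGam sc cU s0.
have s2 : smooth_on W F2 := smooth_cov_along oU oW sGam sc cU s1.
have nW s : W s -> nbhs (s : R^o) W by move=> Ws; exact: open_nbhs_nbhs.
have step (F : R^o -> 'rV[R]_4) : smooth_on W F -> (forall s, I s -> W s -> F s = 0) ->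
    forall s, I s -> W s -> cov_along (D i) c F s = 0.
  move=> sF F0' s Is Ws; rewrite /cov_along (F0' s Is Ws) christoffel0r addr0.
  apply: (derive_zero_on_interval hI Is (nW s Ws) _ F0').
  by apply: diff_derivable; exact: smooth_differentiable sF Ws.
have z1 s : I s -> W s -> F1 s = 0.
  by move=> Is Ws; exact: (geo i s Is (Wdom s Ws)).
have z2 := step F1 s1 z1; have z3 := step F2 s2 z2.
(* Zero is written as a multiple of a vector so that homogeneity of the curvature in its second
   argument removes the term. *)
have -> : nablaT D gamma (velocity gamma) i t = 0 *: (0 : 'rV[R]_4).
  by rewrite scale0r; exact: z1.
rewrite (curvature_atZm oU sGam 0 _ 0 _ (cU t Wt)) scale0r subr0.
exact: z3.
Qed.

Variables (N B1 B2 : field_along I gamma) (k1 k2 k3 : R -> R).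
Hypotheses (hk1 : smooth_fun I k1) (hk2 : smooth_fun I k2).
Hypothesis hframe : orthonormal_frame g I gamma (velocity gamma) N B1 B2.
Hypothesis hfrenet : frenet_equations D I gamma (velocity gamma) N B1 B2 k1 k2 k3.
Hypothesis hC : conformally_flat g D \/ quasi_conformally_flat g D \/
    conformally_symmetric g D.

(** If [k1 t] is nonzero, then [k1] has no zero near [t], in particular on some open [J] inside [I].
    The contradiction arises on [J], which need not contain [t]. *)
Lemma biharmonic_curvature_zero t : is_biharmonic D I gamma -> I t ->
  chart_dom i (gamma t) -> k1 t = 0.
Proof.
move=> bih It dt; apply/eqP; apply: contraT => k1t.
have [W [[oW Wt] Wdom sc]] := hgamma It dt.
have [V [oV Vt] sk1] := hk1 It.
have nk1 : \forall s \near (t : R^o), k1 s != 0.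
  have ck1 : {for (t : R^o), continuous (k1 : R^o -> R^o)} := sk1 0 t Vt.
  exact: cvgr_neq0 ck1 k1t.
have nWV : nbhs (t : R^o) [set s | [/\ W s, V s & k1 s != 0]].
  have nW : \forall s \near (t : R^o), W s by exact: open_nbhs_nbhs.
  have nV : \forall s \near (t : R^o), V s by exact: open_nbhs_nbhs.
  by apply: filterS3 nW nV nk1.
have [J [oJ [s0 Js0] JI JW _]] := interval_adherent hI It nWV.
have W_J s (Js : J s) : W s by have [] := JW s Js.
have V_J s (Js : J s) : V s by have [] := JW s Js.
have dom_J s (Js : J s) : chart_dom i (gamma s) := Wdom s (W_J s Js).
have cU s : J s -> U (c s) by move=> Js; exists (gamma s) => //; exact: dom_J.
(* The pointwise coefficients are assembled into a function by choice, so no regularity comes with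
   it; outside [U] the value 0 is arbitrary. *)
have [Cf HCf] : exists Cf : 'rV[R]_4 -> R, forall x, U x ->
    eta_constant (D i) (g i) (xi i) (eta i) x (Cf x).
  have H x : exists r, U x -> eta_constant (D i) (g i) (xi i) (eta i) x r.
    have [Ux|nUx] := pselect (U x); last by exists 0.
    by have [r Hr] := chart_eta_constant Ux hC; exists r.
  by have [Cf H'] := choice H; exists Cf.
have dNi (F : field_along I gamma) s (Js : J s) : derivable (F i : R^o -> 'rV[R]_4) s 1.
  have [V' [oV' V's] sF] := fa_smooth F (JI s Js) (dom_J s Js).
  by apply: diff_derivable; exact: smooth_differentiable sF V's.
have [f1 f2 f3 f4 f5 f6 f7 f8 f9 f10] := hframe.
have [e1 e2 e3 e4] := hfrenet.
have dc s (Js : J s) := smooth_differentiable sc (W_J s Js).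
suff : False by [].
apply: (@frenet_curve_not_biharmonic R U (D i) (g i) (phi i) (xi i) (eta i) Cf
  GC e_xi phi2 g_phi HCf _ _ _ _ _ J c (N i) (B1 i) (B2 i) k1 k2 k3 oJ cU dc
  _ (dNi N) (dNi B1) (dNi B2) _ _ _
  (fun s Js => f1 i s (JI s Js) (dom_J s Js)) (fun s Js => f2 i s (JI s Js)
      (dom_J s Js))
  (fun s Js => f3 i s (JI s Js) (dom_J s Js)) (fun s Js => f4 i s (JI s Js)
      (dom_J s Js))
  (fun s Js => f5 i s (JI s Js) (dom_J s Js)) (fun s Js => f6 i s (JI s Js)
      (dom_J s Js))
  (fun s Js => f7 i s (JI s Js) (dom_J s Js)) (fun s Js => f8 i s (JI s Js)
      (dom_J s Js))
  (fun s Js => f9 i s (JI s Js) (dom_J s Js)) (fun s Js => f10 i s (JI s Js)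
      (dom_J s Js))
  (fun s Js => e1 i s (JI s Js) (dom_J s Js)) (fun s Js => e2 i s (JI s Js)
      (dom_J s Js))
  (fun s Js => e3 i s (JI s Js) (dom_J s Js)) (fun s Js => e4 i s (JI s Js)
      (dom_J s Js))
  _ _ s0 Js0).
- move=> x u Ux; have scu : smooth_on U (fun=> u) by exact: smooth_cst.
  exact: smooth_differentiable (smooth_form1 oU sEta scu) Ux.
- move=> x u v Ux; have scu : smooth_on U (fun=> u) by exact: smooth_cst.
  rewrite -cov_cst.
  exact: (derive_form1 oU sXi GC chart_metric e_xi phi2 g_phi chart_nabla_phi v Ux scu).
- move=> x Ux; have str : smooth_on U (fun y => \tr (phi i y) / 3).
    apply: smoothM => //; last exact: smooth_cst.
    have sP := (smooth_mxP oU (phi i)).1 sPhi.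
    have := @smooth_sum _ _ _ oU _ _ (index_enum 'I_4) _ (fun l => sP l l).
    by [].
  exact: smooth_differentiable str Ux.
- move=> x u Ux h0.
  exact: (eta_constant_differentiable oU sGam sG sEta GC e_xi phi2 g_phi Ux HCf h0).
- move=> x Ux dCf Cf0.
  have nU : \forall y \near x, U y by exact: open_nbhs_nbhs.
  apply: (eta_constant_rigidity oU sGam sG sXi sEta GC metric_unit chart_torsion_free
    chart_metric e_xi phi2 g_phi chart_nabla_phi Ux dCf _ Cf0).
  by apply: filterS nU => y; exact: HCf.
- move=> s Js; apply: diff_derivable.
  by apply: (smooth_differentiable _ (W_J s Js)); exact: smooth_derive.
- by move=> s Js; apply: diff_derivable; exact: smooth_differentiable sk1 (V_J s Js).
- move=> s Js; apply: diff_derivable.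
  by apply: (smooth_differentiable _ (V_J s Js)); exact: smooth_derive.
- move=> s Js; have [V' [oV' V's] sk2] := hk2 (JI s Js).
  by apply: diff_derivable; exact: smooth_differentiable sk2 V's.
- by move=> s Js; apply: subr0_eq; exact: (bih i s (JI s Js) (dom_J s Js)).
- by move=> s Js; have [] := JW s Js.
Qed.
End Curve.
End Chart.

Theorem theorem3p4 (R : realType) (M : manifold R 4)
    (phi : endo_field M) (xi : vector_field M) (eta : one_form M)
    (g : lorentz_metric M) (D : connection M)
    (hM : is_LP_sasakian g D phi xi eta)
    (hC : conformally_flat g D \/ quasi_conformally_flat g D \/
          conformally_symmetric g D)
    (I : set R) (hI : nondegenerate_interval I)
    (gamma : R -> M) (hgamma : smooth_curve I gamma)
    (harc : spacelike_arclength g I gamma)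
    (N B1 B2 : field_along I gamma) (k1 k2 k3 : R -> R)
    (hk1 : smooth_fun I k1) (hk2 : smooth_fun I k2) (hk3 : smooth_fun I k3)
    (hframe : orthonormal_frame g I gamma (velocity gamma) N B1 B2)
    (hfrenet : frenet_equations D I gamma (velocity gamma) N B1 B2 k1 k2 k3) :
  is_biharmonic D I gamma <-> is_geodesic D I gamma.
Proof.
split=> [bih i t It dt|geo i t It dt]; last first.
  exact: (geodesic_biharmonic hI hgamma geo It dt).
rewrite (fr_T hfrenet It dt).
by rewrite (biharmonic_curvature_zero hM hI hgamma hk1 hk2 hframe hfrenet hC bih It dt) scale0r.
Qed.
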